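(* Let $\mathcal{L}_T^{(k)}$ be the Laplacian matrix of a $k$-vertex connected threshold graph with degree sequence $\boldsymbol d=(d_1,\dots,d_k)=(\tilde d_1,\dots,\tilde d_1,\dots,\tilde d_{\tilde k},\dots,\tilde d_{\tilde k})$, where $\tilde d_1>\cdots>\tilde d_{\tilde k}$ and $\tilde d_i$ has multiplicity $m_i$. Consider control matrices $B\in\mathbb{R}^{k\times p}$ such that $(\mathcal{L}_T^{(k)},B)$ is controllable. 1. For each $i\in\{1,\dots,\tilde k\}$, let $\tilde B_i$ be the submatrix of $B$ composed of its rows with indices $\bar m_{i-1}+1,\dots,\bar m_i$. For general $B$ (over all $p$ and all real $k\times p$ matrices $B$ with $(\mathcal{L}_T^{(k)},B)$ controllable), the minimum rank of $\tilde B_i$ is $m_i-1$. 2. The minimum $p$ for which there is a binary $B\in\{0,1\}^{k\times p}$ with $(\mathcal{L}_T^{(k)},B)$ controllable is $\max_i m_i^*$, the largest multiplicity of an eigenvalue of $\mathcal{L}_T^{(k)}$. The minimum $p$ for which there is a terminal $B\in\mathbb{R}^{k\times p}$ with $(\mathcal{L}_T^{(k)},B)$ controllable is $k-\tilde k$.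
   Context: All graphs are simple (undirected, unweighted, no loops, no multiple edges) and connected, and $k\ge 2$. The Laplacian matrix is $\mathcal{L}=\mathcal{D}-\mathcal{A}$ (diagonal degree matrix minus adjacency matrix). A threshold graph is a graph obtained from a single isolated vertex by adding vertices one at a time, each new vertex being either isolated or adjacent to all existing vertices. Vertices are numbered so that the degrees satisfy $d_1\ge\cdots\ge d_k$ (vertex $i$ has degree $d_i$), and the rows of $\mathcal{L}_T^{(k)}$ and of $B$ are indexed accordingly. $(\mathcal{L},B)$ denotes the linear time-invariant control system $\dot{\boldsymbol x}=-\mathcal{L}\boldsymbol x+B\boldsymbol u(t)$ with $p$ control inputs, $p$ being the number of columns of $B$; controllability is meant in the usual sense (equivalently, $\mathcal{L}$ has no eigenvector in the null space of $B^T$). $B$ is binary if all its entries are in $\{0,1\}$; terminal if every column of $B$ has exactly one nonzero entry; a general $B$ is an arbitrary real matrix. Notation: $\bar m_0=0$, $\bar m_i=\sum_{j=1}^i m_j$. The conjugate of $\boldsymbol d$ is $\boldsymbol d^*=(d_1^*,\dots,d_k^* )$ with $d_i^*=|\{j:d_j\ge i\}|$; its distinct values in decreasing order are $\tilde d_1^*>\tilde d_2^*>\cdots$, with $\tilde d_i^*$ of multiplicity $m_i^*$. *)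

(* Defs.v *)
From HB Require Import structures.
From mathcomp Require Import all_boot all_order all_algebra.
From mathcomp Require Import all_classical all_reals all_analysis.

Set Implicit Arguments.
Unset Strict Implicit.
Unset Printing Implicit Defensive.

Import Order.TTheory GRing.Theory Num.Theory.
Import numFieldNormedType.Exports.

Local Open Scope ring_scope.

Definition is_minimum (P : nat -> Prop) (n : nat) : Prop :=
  P n /\ forall m, P m -> (n <= m)%N.

Definition is_maximum (P : nat -> Prop) (n : nat) : Prop :=
  P n /\ forall m, P m -> (m <= n)%N.

(* A graph on a finite vertex type V is given by its adjacency relation. *)
Definition simple_graph (V : finType) (e : rel V) : Prop :=
  symmetric e /\ irreflexive e.

Definition graph_connected (V : finType) (e : rel V) : Prop :=
  forall x y : V, connect e x y.

(* [threshold_on e S]: the subgraph of e induced by S is obtained from a single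
   vertex by successively adding isolated or dominating vertices. *)
Inductive threshold_on (V : finType) (e : rel V) : {set V} -> Prop :=
| threshold_single (v : V) : threshold_on e [set v]
| threshold_isolated (S : {set V}) (v : V) :
    threshold_on e S -> v \notin S ->
    (forall w, w \in S -> ~~ e v w) -> threshold_on e (v |: S)
| threshold_dominating (S : {set V}) (v : V) :
    threshold_on e S -> v \notin S ->
    (forall w, w \in S -> e v w) -> threshold_on e (v |: S).

Definition threshold_graph (V : finType) (e : rel V) : Prop :=
  threshold_on e [set: V].

Definition degree (V : finType) (e : rel V) (v : V) : nat :=
  #|[set w | e v w]|.

Definition adjacency (R : realType) (k : nat) (e : rel 'I_k) : 'M[R]_k :=
  \matrix_(i, j) (e i j)%:R.

Definition laplacian (R : realType) (k : nat) (e : rel 'I_k) : 'M[R]_k :=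
  diag_mx (\row_i (degree e i)%:R) - adjacency R e.

Definition degree_seq (k : nat) (e : rel 'I_k) : seq nat :=
  [seq degree e i | i <- enum 'I_k].

(* The i-th entry, 1 <= i <= size d, is |{j : d_j >= i}|. *)
Definition conjugate_seq (d : seq nat) : seq nat :=
  [seq count (fun x => i <= x)%N d | i <- iota 1 (size d)].

(* The distinct values of d in decreasing order. *)
Definition distinct_values (d : seq nat) : seq nat := sort geq (undup d).

(* Indices start at 0: [mult d i] is the multiplicity in d of its
   (i+1)-st largest value. *)
Definition mult (d : seq nat) (i : nat) : nat :=
  count_mem (nth 0%N (distinct_values d) i) d.

Definition mbar (d : seq nat) (i : nat) : nat := (\sum_(j < i) mult d j)%N.

(* The system x' = - L x + B u can be steered from any state to any other in
   finite time by a continuous input. *)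
Definition controllable (R : realType) (k p : nat)
    (L : 'M[R]_k) (B : 'M[R]_(k, p)) : Prop :=
  forall x0 x1 : 'cV[R]_k,
  exists (T : R) (u : R -> 'cV[R]_p) (x : R -> 'cV[R]_k),
    [/\ 0 < T,
        {within `[0, T], continuous u}%classic,
        {within `[0, T], continuous x}%classic,
        (forall t : R, 0 < t < T ->
           is_derive t 1 x (- L *m x t + B *m u t)) &
        x 0 = x0 /\ x T = x1].

Definition binary_mx (R : realType) (k p : nat) (B : 'M[R]_(k, p)) : Prop :=
  forall i j, B i j = 0 \/ B i j = 1.

Definition terminal_mx (R : realType) (k p : nat) (B : 'M[R]_(k, p)) : Prop :=
  forall j, #|[set i | B i j != 0]| = 1%N.

(* Rows a, a + 1, ..., b - 1 of B, indices starting at 0. *)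
Definition row_block (R : realType) (k p : nat) (a b : nat)
    (B : 'M[R]_(k, p)) : 'M[R]_(#|[set r : 'I_k | (a <= r < b)%N]|, p) :=
  rowsub enum_val B.

(* Main.v *)
Require Import Defs.
From HB Require Import structures.
From mathcomp Require Import all_boot all_order all_algebra.
From mathcomp Require Import all_classical all_reals all_analysis.
From mathcomp Require Import ring zify.

Set Implicit Arguments.
Unset Strict Implicit.
Unset Printing Implicit Defensive.

Import Order.TTheory GRing.Theory Num.Theory.
Import numFieldNormedType.Exports.

Local Open Scope ring_scope.

(** A threshold graph has an explicit Laplacian eigenbasis.  List the vertices
    in construction order and let [T n] say that the vertex at position [n]
    was added as a dominating one.  For [1 <= n <= k], the vector with entries
    1 at the positions before [n], [- n] at [n] and 0 afterwards is an
    eigenvector, of eigenvalue [T n * (n + 1)] plus the number of dominating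
    vertices added after [n] ([mode_laplacian]); for [n = k] it is the constant
    vector.  Two of these eigenvalues agree exactly on a run of equal values of
    [T], and then the vertices of the run also have the same degree
    ([pos_eigenvalue_between]).  A direct count identifies the list of
    eigenvalues with the conjugate degree sequence ([conj_perm]).

    Controllability is used only through the eigenvector test.  If
    [v *m L = a *: v] and [v *m B = 0], then [expR (a * t) * (v *m x t)] is
    constant along every trajectory, so no control can reach [v^T] from 0
    ([controllable_left_eigenvector]).  Conversely, when [L] is diagonalizable
    and passes the test, a polynomial control is built mode by mode from a
    Hermite interpolation at the two ends of the time interval
    ([controllable_of_modes]).

    Lower bounds.  Vertices of equal degree are twins, so every vector
    supported on a degree class with zero sum is an eigenvector.  Such a vector
    in the left kernel of [B] exists as soon as the rows of [B] on the class
    have rank less than the size of the class minus one, or as soon as two of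
    these rows vanish.  An eigenspace of dimension larger than the number of
    columns of [B] always meets the left kernel of [B].

    Constructions.  An eigenvector is constant on the positions before some
    [n], and from [n] on it is supported on a single run; unless it is constant
    it has zero sum ([eigenvector_shape]).  Hence it vanishes as soon as it is
    zero outside one representative of each degree class, which makes the
    terminal matrix selecting all the other vertices controllable; on each
    degree class its rows have rank one less than the size of the class.  For
    binary matrices, the first vertex gets a zero row and the vertices of a run
    get distinct unit vectors.  If such a matrix annihilates an eigenvector,
    the entries other than the first one sum to zero; so does the
    whole vector, or else it is constant; either way the first entry is 0, and
    with it every entry before the run, and then the unit vectors detect each
    entry of the run. *)

(** * Controllability forces left eigenvectors to see the input *)

(** Reduces the vector differential equation in the definition of
    [controllable] to scalar ones. *)
Lemma is_derive_colP (R : realType) (n : nat) (x : R -> 'cV[R]_n) (t : R)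
    (x' : 'cV[R]_n) :
  is_derive t 1 x x' <-> forall i, is_derive t 1 (fun s => x s i 0) (x' i 0).
Proof.
split=> [[dx ex] i|dx].
  apply: DeriveDef; first exact: (derivable_mxP _ _ _).1 dx i 0.
  by rewrite -ex derive_mx // mxE.
have d : derivable x t 1.
  by apply/derivable_mxP => i j; rewrite ord1; have [] := dx i.
apply: DeriveDef => //; rewrite derive_mx //.
by apply/matrixP => i j; rewrite ord1 mxE; have [_ ->] := dx i.
Qed.

(** Along a trajectory, [y = v *m x] satisfies [y' = - a y] whatever the input
    is, so that [expR (a * t) * y t] is constant.  Steering from 0 to [v^T]
    would make [y] go from 0 to the squared norm of [v]. *)
Lemma controllable_left_eigenvector (R : realType) (k p : nat)
    (L : 'M[R]_k) (B : 'M[R]_(k, p)) (v : 'rV[R]_k) (a : R) :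
  controllable L B -> v *m L = a *: v -> v *m B = 0 -> v = 0.
Proof.
move=> /(_ 0 v^T)[T [u [x [T0 _ cx dx [x0 xT]]]]] vL vB.
pose y s : R := \sum_i v 0 i * x s i 0.
have yE s : y s = (v *m x s) 0 0 by rewrite mxE.
have dy t : 0 < t < T -> is_derive t 1 y (- a * y t).
  move=> /dx /is_derive_colP dxt.
  have dvx i : is_derive t 1 (fun s => v 0 i *: x s i 0)
                 (v 0 i *: (- L *m x t + B *m u t) i 0).
    by apply: is_deriveZ; exact: dxt.
  have := is_derive_sum dvx; rewrite (_ : \sum_i _ = y :> (R -> R)); last first.
    by apply/funext => s; rewrite fct_sumE.
  suff -> : \sum_(i < k) v 0 i *: (- L *m x t + B *m u t) i 0 = - a * y t by [].
  have : (v *m (- L *m x t + B *m u t)) 0 0 = - a * (v *m x t) 0 0.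
    rewrite mulmxDr mulNmx mulmxN !mulmxA vL vB mul0mx addr0 -scalemxAl !mxE.
    by rewrite mulNr.
  by rewrite yE => <-; rewrite mxE.
have cy : {within `[0, T], continuous y}%classic.
  move=> s; rewrite /y.
  have -> : (fun s => \sum_i v 0 i * x s i 0) =
            (fun M : 'cV[R]_k => \sum_i v 0 i * M i 0) \o x by [].
  apply: (@cvg_comp _ _ _ x _ _ _ _ (cx s)).
  apply: cvg_big => [|i _]; first exact: add_continuous.
  apply: cvgM; first exact: cvg_cst.
  exact: coord_continuous.
pose g s : R := expR (a * s) * y s.
have dg t : t \in `]0, T[ -> is_derive t 1 g 0.
  rewrite in_itv /= => /dy dyt.
  have de : is_derive t 1 (fun s => expR (a * s)) (a * expR (a * t)).
    have : is_derive t 1 (expR \o (a \*: id)) (expR (a * t) * (a *: 1)).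
      apply: is_derive1_comp; exact: is_derive_expR.
    by rewrite /= [_ *: _]mulr1 mulrC.
  have -> : g = (fun s => expR (a * s)) * y by [].
  apply: is_derive_eq; rewrite /GRing.scale /=; ring.
have cg : {within `[0, T], continuous g}%classic.
  move=> s; apply: cvgM; last exact: cy.
  apply: (@continuous_subspaceT _ _ _ (fun s => expR (a * s))) => r.
  apply: (@continuous_comp _ _ _ (fun s => a * s) expR); last exact: continuous_expR.
  exact: mulrl_continuous.
have [c _] := MVT T0 dg cg; rewrite mul0r => /eqP; rewrite subr_eq0 => /eqP.
have y0 : y 0 = 0 by rewrite yE x0 mulmx0 mxE.
rewrite /g y0 mulr0 => /eqP; rewrite mulf_eq0 gt_eqF ?expR_gt0 //=.
rewrite yE xT mxE psumr_eq0; last by move=> i _; rewrite mxE -expr2 sqr_ge0.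
move=> /allP h; apply/rowP => i; rewrite [RHS]mxE; apply/eqP.
by have := h i (mem_index_enum _); rewrite mxE mulf_eq0 orbb.
Qed.

(** * Steering a diagonalizable system by polynomials *)

(** The differential operator [\prod_(a <- s) (d/dt + a)]. *)
Definition diffop (R : nzRingType) (s : seq R) (f : {poly R}) : {poly R} :=
  foldr (fun a g => g^`() + a *: g) f s.

(** At [t], the derivatives of [f] up to order [n] are those of [c] times the
    exponential of [- b (x - t)], on which [diffop] acts by a scalar.  With
    [c = 0], [f] vanishes at [t] to order greater than [n]. *)
Definition exp_jet (R : nzRingType) (n : nat) (t b c : R) (f : {poly R}) : Prop :=
  forall j, (j <= n)%N -> (f^`(j)).[t] = c * (- b) ^+ j.

Lemma diffop_linear (R : comNzRingType) (s : seq R) (I : Type) (r : seq I)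
    (c : I -> R) (f : I -> {poly R}) :
  diffop s (\sum_(i <- r) c i *: f i) = \sum_(i <- r) c i *: diffop s (f i).
Proof.
elim: s => //= a s ->; rewrite raddf_sum scaler_sumr -big_split /=.
by apply: eq_bigr => i _; rewrite derivZ scalerDr !scalerA mulrC.
Qed.

(** The factors of [diffop] commute, so any of them can be applied last. *)
Lemma diffop_rem (R : comNzRingType) (s : seq R) (a : R) (f : {poly R}) :
  a \in s -> diffop s f = (diffop (rem a s) f)^`() + a *: diffop (rem a s) f.
Proof.
elim: s => //= b s IHs; rewrite inE eq_sym; have [-> //|_ /= /IHs ->] := eqVneq b a.
rewrite !derivD !derivZ !scalerDr !scalerA [b * a]mulrC -!addrA; congr (_ + _).
by rewrite !addrA; congr (_ + _); rewrite addrC.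
Qed.

(** Each factor [d/dt + a] multiplies the exponential of [- b x] by [a - b] and
    uses up one order of contact. *)
Lemma diffop_exp_jet (R : comNzRingType) (s : seq R) n (t b c : R) (f : {poly R}) :
  exp_jet (n + size s) t b c f ->
  exp_jet n t b (c * \prod_(a <- s) (a - b)) (diffop s f).
Proof.
elim: s n => [|a s IHs] n /= jf; first by rewrite big_nil mulr1 -[n]addn0.
have {}jf : exp_jet n.+1 t b (c * \prod_(a <- s) (a - b)) (diffop s f).
  by apply: IHs; rewrite addSnnS.
move=> j jn; rewrite derivnD derivnZ hornerD hornerZ big_cons.
rewrite -derivSn !jf ?ltnS //; last exact: leqW.
by rewrite exprS; ring.
Qed.

Lemma derivn_comp_XsubC (R : comNzRingType) (p : {poly R}) (t : R) n :
  (p \Po ('X - t%:P))^`(n) = p^`(n) \Po ('X - t%:P).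
Proof.
elim: n => // n IHn; rewrite !derivnS IHn deriv_comp.
by rewrite derivB derivX derivC subr0 mulr1.
Qed.

Lemma dvdp_exp_derivn_horner (R : fieldType) (t : R) (h : {poly R}) n j :
  ('X - t%:P) ^+ n.+1 %| h -> (j <= n)%N -> (h^`(j)).[t] = 0.
Proof.
elim: n j h => [|n IHn] [|j] h // dv.
- by move=> _; apply/eqP; rewrite -/(root _ _) -dvdp_XsubCl.
- by move=> _; apply: (IHn 0%N) => //; apply: dvdp_trans dv; apply: dvdp_exp2l.
rewrite ltnS derivSn => /(IHn j); apply.
case/dvdpP: dv => q ->; rewrite derivM deriv_exp derivB derivX derivC subr0 mul1r.
apply: dvdp_add; apply: dvdp_mull; first exact: dvdp_exp2l.
by rewrite -mulr_natl dvdp_mull.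
Qed.

(** Hermite interpolation at two points: take the Taylor polynomial at [t0] and
    multiply it by a polynomial that is 1 modulo ['X - t0] to the power [n + 1]
    and 0 modulo ['X - t1] to the power [n + 1], which Bezout provides. *)
Lemma exp_jet_exists (R : numFieldType) n (t0 t1 b : R) : t0 != t1 ->
  exists f, exp_jet n t0 b 1 f /\ exp_jet n t1 b 0 f.
Proof.
move=> t01.
pose g := (\poly_(j < n.+1) ((- b) ^+ j / j`!%:R)) \Po ('X - t0%:P).
have /Bezout_eq1_coprimepP[[u v] /= uv] :
    coprimep (('X - t0%:P) ^+ n.+1) (('X - t1%:P) ^+ n.+1).
  by apply/coprimep_expl/coprimep_expr/coprimep_XsubC2; rewrite subr_eq0 eq_sym.
exists (g * (v * ('X - t1%:P) ^+ n.+1)); split=> j jn; last first.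
  by rewrite mul0r (dvdp_exp_derivn_horner _ jn) // mulrA dvdp_mull.
have -> : v * ('X - t1%:P) ^+ n.+1 = 1 - u * ('X - t0%:P) ^+ n.+1.
  by rewrite -uv [RHS]addrC addKr.
have ->: ((g * (1 - u * ('X - t0%:P) ^+ n.+1))^`(j)).[t0] = (g^`(j)).[t0].
  rewrite mulrBr mulr1 derivnB hornerD hornerN.
  rewrite [X in _ - X](dvdp_exp_derivn_horner _ jn) ?subr0 //.
  by rewrite mulrA dvdp_mull.
rewrite derivn_comp_XsubC horner_comp hornerXsubC subrr horner_coef0.
rewrite coef_derivn addn0 coef_poly ltnS jn ffactnn mul1r -[LHS]mulr_natr divfK //.
Qed.

(** If [b <> a], removing [a] from [s] leaves the factor [d/dt + b], which
    kills the exponential of [- b x]; so only the operator without [b] gives a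
    nonzero value at [t0]. *)
Lemma diffop_separates (R : numFieldType) (s : seq R) (t0 t1 b : R) :
  uniq s -> b \in s -> t0 != t1 ->
  exists f, forall a, a \in s ->
    (diffop (rem a s) f).[t0] = (a == b)%:R /\ (diffop (rem a s) f).[t1] = 0.
Proof.
move=> us bs /(exp_jet_exists (size s) b) [f [f0 f1]].
pose c := \prod_(a <- rem b s) (a - b).
have c0 : c != 0.
  rewrite prodf_seq_neq0; apply/allP => a /=.
  by rewrite mem_rem_uniq // inE subr_eq0 => /andP[].
have ev t d a : exp_jet (size s) t b d f -> a \in s ->
    (diffop (rem a s) f).[t] = d * \prod_(a' <- rem a s) (a' - b).
  move=> jf as_; have : exp_jet (0 + size (rem a s)) t b d f.
    move=> j; rewrite add0n => jn; apply: jf; apply: leq_trans jn _.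
    by rewrite size_rem // leq_pred.
  by move=> /diffop_exp_jet /(_ 0%N (leqnn _)); rewrite derivn0 expr0 mulr1.
exists (c^-1 *: f) => a as_.
have -> : diffop (rem a s) (c^-1 *: f) = c^-1 *: diffop (rem a s) f.
  by have := diffop_linear (rem a s) [:: tt] (fun=> c^-1) (fun=> f); rewrite !big_seq1.
rewrite !hornerZ (ev _ _ _ f0 as_) (ev _ _ _ f1 as_) mul1r mul0r mulr0; split=> //.
have [->|ab] := eqVneq a b; first by rewrite mulVf.
rewrite (_ : \prod_(_ <- _) _ = 0) ?mulr0 //; apply/eqP; rewrite prodf_seq_eq0.
by apply/hasP; exists b; rewrite ?subrr //= mem_rem_uniq // inE eq_sym ab.
Qed.

(** The modes of eigenvalue [a] can be prescribed independently through [B]: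
    by duality, a linear relation between their rows in [W *m B] would give a
    left eigenvector of [L] annihilated by [B]. *)
Lemma modal_system_solvable (R : fieldType) (k p : nat) (W L : 'M[R]_k)
    (mu : 'rV[R]_k) (B : 'M[R]_(k, p)) (a : R) (y : 'cV[R]_k) :
  W \in unitmx -> W *m L = diag_mx mu *m W ->
  (forall v : 'rV[R]_k, v *m L = a *: v -> v *m B = 0 -> v = 0) ->
  exists z : 'cV[R]_p, forall j, mu 0 j = a -> (W *m B *m z) j 0 = y j 0.
Proof.
move=> uW WL pbh.
(* the projection onto the modes of eigenvalue [a] *)
pose P : 'M[R]_k := diag_mx (\row_j (mu 0 j == a)%:R).
have : ((P *m y)^T <= (P *m W *m B)^T)%MS.
  rewrite submxE -trmx_eq0 trmx_mul trmxK mulmxA.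
  set K := (cokermx _)^T.
  have KB : K *m (P *m W *m B) = 0.
    by rewrite -[LHS]trmxK trmx_mul /K trmxK mulmx_coker trmx0.
  suff -> : K *m P = 0 by rewrite mul0mx.
  have PL : P *m W *m L = a *: (P *m W).
    rewrite -mulmxA WL mulmxA mulmx_diag scalemxAl; congr (_ *m _).
    apply/matrixP => i j; rewrite !mxE; case: (i == j); last by rewrite !mulr0n mulr0.
    by rewrite !mulr1n; case: eqP => [->|]; rewrite ?mul0r ?mulr0 // mulrC.
  suff KPW : K *m P *m W = 0 by rewrite -[LHS](mulmxK uW) KPW mul0mx.
  apply/row_matrixP => i; rewrite row0; apply: pbh.
    by rewrite -row_mul -!mulmxA (mulmxA P) PL -scalemxAr row_mul linearZ /= !row_mul.
  by rewrite -row_mul -!mulmxA (mulmxA P) KB row0.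
case/submxP => z yz; exists z^T => j muj.
have /matrixP/(_ j 0) := congr1 trmx yz.
rewrite trmxK trmx_mul trmxK -!mulmxA mul_diag_mx [in RHS]mul_diag_mx !mxE.
by rewrite muj eqxx !mul1r => ->.
Qed.

(** In the coordinates [W *m x] the system splits into the scalar equations
    [y' + mu_j y = (W B)_j u].  Writing the input as [diffop s psi], with [s]
    the list of distinct eigenvalues, each of them is solved by
    [y = (W B)_j (diffop (rem mu_j s) psi)], with no integration.  The values
    of all these operators at times 0 and 1 are prescribed by choosing [psi]
    as a combination of the polynomials of [diffop_separates]. *)
Lemma controllable_of_modes (R : realType) (k p : nat) (W L : 'M[R]_k)
    (mu : 'rV[R]_k) (B : 'M[R]_(k, p)) :
  W \in unitmx -> W *m L = diag_mx mu *m W ->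
  (forall (a : R) (v : 'rV[R]_k), v *m L = a *: v -> v *m B = 0 -> v = 0) ->
  controllable L B.
Proof.
move=> uW WL pbh x0 x1.
pose s := undup [seq mu 0 j | j <- enum 'I_k].
have mus j : mu 0 j \in s by rewrite mem_undup map_f // mem_enum.
have us : uniq s by exact: undup_uniq.
have /choice[z0 z0E] : forall a, exists z : 'cV[R]_p, forall j, mu 0 j = a ->
    (W *m B *m z) j 0 = (W *m x0) j 0.
  by move=> a; apply: (modal_system_solvable _ uW WL); exact: pbh.
have /choice[z1 z1E] : forall a, exists z : 'cV[R]_p, forall j, mu 0 j = a ->
    (W *m B *m z) j 0 = (W *m x1) j 0.
  by move=> a; apply: (modal_system_solvable _ uW WL); exact: pbh.
have /choice[f0 f0E] : forall b, exists f : {poly R}, b \in s -> forall a, a \in s ->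
    (diffop (rem a s) f).[0] = (a == b)%:R /\ (diffop (rem a s) f).[1] = 0.
  move=> b; have [bs|] := boolP (b \in s); last by exists 0.
  by have [f fE] := diffop_separates us bs (negbT (eqr_nat R 0 1)); exists f.
have /choice[f1 f1E] : forall b, exists f : {poly R}, b \in s -> forall a, a \in s ->
    (diffop (rem a s) f).[1] = (a == b)%:R /\ (diffop (rem a s) f).[0] = 0.
  move=> b; have [bs|] := boolP (b \in s); last by exists 0.
  by have [f fE] := diffop_separates us bs (negbT (eqr_nat R 1 0)); exists f.
(* [z0] and [z1] encode the initial and the final state *)
pose psi (l : 'I_p) : {poly R} :=
  \sum_(b <- s) z0 b l 0 *: f0 b + \sum_(b <- s) z1 b l 0 *: f1 b.
pose y j : {poly R} := \sum_l (W *m B) j l *: diffop (rem (mu 0 j) s) (psi l).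
pose u t : 'cV[R]_p := \col_l (diffop s (psi l)).[t].
pose Y t : 'cV[R]_k := \col_j (y j).[t].
have psiE a t l : (diffop (rem a s) (psi l)).[t] =
    \sum_(b <- s) z0 b l 0 * (diffop (rem a s) (f0 b)).[t] +
    \sum_(b <- s) z1 b l 0 * (diffop (rem a s) (f1 b)).[t].
  have dD f g : diffop (rem a s) (f + g) = diffop (rem a s) f + diffop (rem a s) g.
    have := diffop_linear (rem a s) [:: true; false] (fun=> 1) (fun b => if b then f else g).
    by rewrite !big_cons !big_nil !addr0 !scale1r.
  rewrite dD !diffop_linear hornerD !horner_sum.
  by congr (_ + _); apply: eq_bigr => b _; rewrite hornerZ.
have pick (c : R -> R) a : a \in s -> \sum_(b <- s) c b * (a == b)%:R = c a.
  move=> as_; rewrite (bigD1_seq a) //= eqxx mulr1 big1 ?addr0 // => b ba.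
  by rewrite eq_sym (negbTE ba) mulr0.
have Y0 : Y 0 = W *m x0.
  apply/colP => j; rewrite mxE -(z0E _ _ erefl) [RHS]mxE horner_sum.
  apply: eq_bigr => l _; rewrite hornerZ psiE; congr (_ * _).
  rewrite [X in _ + X]big1_seq => [|b /andP[_ bs]]; last first.
    by have [_ ->] := f1E b bs _ (mus j); rewrite mulr0.
  rewrite addr0 -[RHS](pick (fun b => z0 b l 0) _ (mus j)).
  by apply: eq_big_seq => b bs; have [->] := f0E b bs _ (mus j).
have Y1 : Y 1 = W *m x1.
  apply/colP => j; rewrite mxE -(z1E _ _ erefl) [RHS]mxE horner_sum.
  apply: eq_bigr => l _; rewrite hornerZ psiE; congr (_ * _).
  rewrite big1_seq => [|b /andP[_ bs]]; last first.
    by have [_ ->] := f0E b bs _ (mus j); rewrite mulr0.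
  rewrite add0r -[RHS](pick (fun b => z1 b l 0) _ (mus j)).
  by apply: eq_big_seq => b bs; have [->] := f1E b bs _ (mus j).
have dy j : (y j)^`() + mu 0 j *: y j = \sum_l (W *m B) j l *: diffop s (psi l).
  rewrite raddf_sum scaler_sumr -big_split; apply: eq_bigr => l _ /=.
  by rewrite derivZ !scalerA [mu 0 j * _]mulrC -scalerA -scalerDr -diffop_rem.
have dx t : is_derive t (1 : R) (fun t => invmx W *m Y t)
    (- L *m (invmx W *m Y t) + B *m u t).
  apply/is_derive_colP => i.
  have -> : (fun s => (invmx W *m Y s) i 0) = horner (\sum_j invmx W i j *: y j).
    apply/funext => r; rewrite mxE horner_sum; apply: eq_bigr => j _.
    by rewrite mxE hornerZ.
  suff <- : (\sum_j invmx W i j *: y j)^`().[t] =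
            (- L *m (invmx W *m Y t) + B *m u t) i 0 by exact: is_derive_poly.
  have LW : L *m invmx W = invmx W *m diag_mx mu.
    by apply: (canLR (mulmxK uW)); rewrite -mulmxA -WL mulKmx.
  have -> : B *m u t = invmx W *m (W *m B *m u t) by rewrite -mulmxA mulKmx.
  have -> : - L *m (invmx W *m Y t) = invmx W *m - (diag_mx mu *m Y t).
    by rewrite mulNmx mulmxA LW -mulmxA mulmxN.
  rewrite -mulmxDr mxE raddf_sum horner_sum.
  apply: eq_bigr => j _; rewrite /= derivZ hornerZ; congr (_ * _).
  have -> : (y j)^`() = \sum_l (W *m B) j l *: diffop s (psi l) - mu 0 j *: y j.
    by rewrite -dy addrK.
  rewrite hornerD hornerN hornerZ horner_sum addrC mul_diag_mx !mxE; congr (_ + _).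
  by apply: eq_bigr => l _; rewrite hornerZ !mxE.
exists 1, u, (fun t => invmx W *m Y t); split.
- exact: ltr01.
- apply: derivable_within_continuous => t _; apply/derivable_mxP => l j.
  rewrite (_ : (fun r => u r l j) = horner (diffop s (psi l))); last first.
    by apply/funext => r; rewrite mxE.
  exact: derivable_horner.
- by apply: derivable_within_continuous => t _; have [] := dx t.
- by move=> t _; exact: dx.
- by rewrite Y0 Y1 !mulKmx.
Qed.

(** * Arithmetic of a threshold construction sequence *)

Definition dominating_after (k : nat) (T : pred nat) (n : nat) : nat :=
  (\sum_(n.+1 <= m < k) T m)%N.

(** The degree of the vertex at position [n] ([degreeE]). *)
Definition pos_degree (k : nat) (T : pred nat) (n : nat) : nat :=
  (T n * n + dominating_after k T n)%N.

(** For [1 <= n <= k], the [n]-th Laplacian eigenvalue ([mode_laplacian]).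
    Position [k], where no vertex sits, gives the eigenvalue 0. *)
Definition pos_eigenvalue (k : nat) (T : pred nat) (n : nat) : nat :=
  (T n * n.+1 + dominating_after k T n)%N.

Definition step_types (k : nat) (T : pred nat) : Prop := forall n, T n -> (n < k)%N.

Lemma dominating_afterS k T n : step_types k T ->
  dominating_after k T n = (T n.+1 + dominating_after k T n.+1)%N.
Proof.
move=> Tk; rewrite /dominating_after; have [nk|kn] := ltnP n.+1 k.
  by rewrite big_ltn.
by rewrite !big_geq //; [case: (boolP (T n.+1)) => // /Tk; lia | lia].
Qed.

Lemma dominating_after_bounds k T m n : step_types k T -> (m <= n)%N ->
  (dominating_after k T n <= dominating_after k T m <= n - m + dominating_after k T n)%N.
Proof.
move=> Tk; elim: n => [|n IHn]; first by rewrite leqn0 => /eqP ->; lia.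
rewrite leq_eqVlt => /predU1P[->|]; first by lia.
rewrite ltnS => mn; have := IHn mn; have := dominating_afterS n Tk.
by case: (T n.+1) => /=; lia.
Qed.

Lemma dominating_after_bounds_at k T m n : step_types k T -> (m < n)%N ->
  (T n + dominating_after k T n <= dominating_after k T m <=
   n.-1 - m + T n + dominating_after k T n)%N.
Proof.
case: n => // n Tk mn; have := dominating_after_bounds Tk mn; have := dominating_afterS n Tk.
by have := dominating_after_bounds Tk (mn : (m <= n)%N); lia.
Qed.

Lemma dominating_after0 k T n : (k <= n)%N -> dominating_after k T n = 0%N.
Proof. by move=> kn; rewrite /dominating_after big_geq //; lia. Qed.

(** Between [m] and [n] the count of later dominating vertices drops by at most
    the number of steps, with equality only if all steps are dominating, and it
    stays constant only if no step is.  Any other pattern makes the eigenvalues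
    differ. *)
Lemma pos_eigenvalue_run k T m n l : step_types k T ->
  pos_eigenvalue k T m = pos_eigenvalue k T n -> (m <= l <= n)%N -> T l = T m.
Proof.
rewrite /pos_eigenvalue => Tk; case/altP: (m =P l) => [->//|ml] E /andP[ml' ln].
have {ml'}ml : (m < l)%N by lia.
have := dominating_after_bounds_at Tk ml; have := dominating_after_bounds Tk ln.
have := dominating_after_bounds_at Tk (leq_trans ml ln).
by move: E; case: (T m) (T n) (T l) => [] [] [] //=; lia.
Qed.

(** One step inside a run of dominating vertices trades a later dominating
    vertex for one more earlier vertex; inside a run of isolated ones, both
    counts stay the same. *)
Lemma pos_eigenvalue_between k T m n l : step_types k T ->
  pos_eigenvalue k T m = pos_eigenvalue k T n -> (m <= l <= n)%N ->
  pos_eigenvalue k T l = pos_eigenvalue k T m /\ pos_degree k T l = pos_degree k T m.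
Proof.
move=> Tk E; have run j : (m <= j <= n)%N -> T j = T m.
  exact: (pos_eigenvalue_run Tk E).
elim: l => [|l IHl]; first by case/andP; rewrite leqn0 => /eqP <-.
case/andP; rewrite leq_eqVlt => /predU1P[->//|ml] ln.
have [|<- <-] := IHl; first by lia.
have := dominating_afterS l Tk; rewrite /pos_eigenvalue /pos_degree !run; lia.
Qed.

(** The first two vertices are twins, whichever type the second one has. *)
Lemma pos_degree01 k T : step_types k T -> pos_degree k T 0%N = pos_degree k T 1%N.
Proof. by move=> Tk; have := dominating_afterS 0%N Tk; rewrite /pos_degree; lia. Qed.

(** The index [i], counted from 1, of the entry of the conjugate degree
    sequence that equals the [n]-th eigenvalue ([conj_count]). *)
Definition conj_index (k : nat) (T : pred nat) (n : nat) : nat :=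
  (if T n then (dominating_after k T n).+1 else n + dominating_after k T n)%N.

Lemma conj_index_range k T n : step_types k T -> (0 < n <= k)%N ->
  (0 < conj_index k T n <= k)%N.
Proof.
move=> Tk /andP[n0 nk]; rewrite /conj_index.
have := dominating_after_bounds Tk nk; rewrite (dominating_after0 T (leqnn k)).
by case: (T n); lia.
Qed.

Lemma conj_index_inj k T m n : step_types k T -> (0 < m)%N -> (0 < n)%N ->
  conj_index k T m = conj_index k T n -> m = n.
Proof.
move=> Tk; wlog: m n / (m < n)%N => [hw m0 n0 E|mn m0 n0].
  by have [mn|nm|//] := ltngtP m n; [exact: hw | apply/esym/hw].
have := dominating_after_bounds_at Tk mn; rewrite /conj_index.
by case: (T m) (T n) => [] [] /=; lia.
Qed.

Lemma count_iotaE (P : pred nat) a n :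
  count P (iota a n) = (\sum_(a <= m < a + n) P m)%N.
Proof.
rewrite -sum1_count big_mkcond /index_iota addKn.
by apply: eq_bigr => i _; case: (P i).
Qed.

(** If [T n], the vertices of degree at least [conj_index k T n] are those up
    to [n] and the later dominating ones; otherwise they are only the later
    dominating ones. *)
Lemma conj_count k T n : step_types k T -> (0 < n <= k)%N ->
  count (fun m => conj_index k T n <= pos_degree k T m)%N (iota 0 k) =
  pos_eigenvalue k T n.
Proof.
move=> Tk /andP[n0 nk].
(* the positions whose degree is at least [conj_index k T n] *)
pose P m := if T n then (m <= n)%N || T m else (n < m)%N && T m.
have -> : count (fun m => conj_index k T n <= pos_degree k T m)%N (iota 0 k) =
          count P (iota 0 k).
  apply: eq_in_count => m; rewrite mem_iota => /andP[_ mk].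
  rewrite /P /conj_index /pos_degree; have [mn|nm|->] := ltngtP m n.
  - have := dominating_after_bounds_at Tk mn.
    by case: (T m) (T n) => [] [] /=; lia.
  - have := dominating_after_bounds_at Tk nm.
    by case: (T m) (T n) => [] [] /=; lia.
  by case: (T n) => /=; lia.
rewrite count_iotaE add0n /pos_eigenvalue /P; case: (boolP (T n)) => Tn.
  have nk' := Tk _ Tn; rewrite (big_cat_nat (n := n.+1)) //=; congr addn.
    rewrite mul1n -[RHS](subn0 n.+1) -[RHS]muln1 -sum_nat_const_nat.
    by apply: eq_big_nat => m; rewrite /= ltnS => ->.
  by apply: eq_big_nat => m /andP[nm _]; rewrite leqNgt nm.
rewrite mul0n add0n; have [kn|nk'] := leqP k n.
  rewrite dominating_after0 // big_nat big1 // => m /andP[_ mk].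
  by rewrite ltnNge (leq_trans (ltnW mk)).
rewrite (big_cat_nat (n := n.+1)) //= big_nat big1 => [|m /=]; last first.
  by rewrite ltnS leqNgt => /negbTE ->.
by apply: eq_big_nat => m /andP[-> _].
Qed.

Lemma conj_perm k T : step_types k T ->
  perm_eq [seq count (fun m => i <= pos_degree k T m)%N (iota 0 k) | i <- iota 1 k]
          [seq pos_eigenvalue k T n | n <- iota 1 k].
Proof.
move=> Tk; set c := fun i => count _ _.
have rangeP n : n \in iota 1 k -> (0 < n <= k)%N by rewrite mem_iota add1n ltnS.
have -> : [seq pos_eigenvalue k T n | n <- iota 1 k] =
          map c [seq conj_index k T n | n <- iota 1 k].
  by rewrite -map_comp; apply/eq_in_map => n /rangeP nk; rewrite /= -conj_count.
have u : uniq [seq conj_index k T n | n <- iota 1 k].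
  rewrite map_inj_in_uniq ?iota_uniq // => m n /rangeP /andP[m0 _] /rangeP/andP[n0 _].
  exact: conj_index_inj.
apply/perm_map; rewrite perm_sym; apply: uniq_perm => //; first exact: iota_uniq.
have [||//] := uniq_min_size u (s2 := iota 1 k); last by rewrite size_map.
move=> _ /mapP[n /rangeP nk ->]; rewrite mem_iota add1n ltnS.
exact: conj_index_range.
Qed.

(** * Laplacian eigenbasis of a threshold graph *)

(** [pos] numbers the vertices from 0 in an order of construction, and [T]
    gives the type of the vertex at each position; it is false from [k] on. *)
Definition construction_order (k : nat) (e : rel 'I_k) (pos : 'I_k -> 'I_k)
    (T : pred nat) : Prop :=
  [/\ injective pos, step_types k T &
      forall u v : 'I_k, (pos u < pos v)%N -> e u v = T (pos v)].

(** By induction on the construction: the vertices added so far are kept in a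
    sequence, and a new vertex is appended to it. *)
Lemma threshold_construction_order (k : nat) (e : rel 'I_k) :
  symmetric e -> threshold_graph e ->
  exists (pos : 'I_k -> 'I_k) (T : pred nat), construction_order e pos T.
Proof.
move=> esym thr.
have [s [us sall [T Ts]]] : exists s : seq 'I_k, [/\ uniq s, [set: 'I_k] =i s &
    exists T : pred nat, forall u v, v \in s -> (index u s < index v s)%N ->
      e u v = T (index v s)].
  have step (S : {set 'I_k}) (v : 'I_k) s (T : pred nat) b : uniq s -> S =i s ->
      (forall u v, v \in s -> (index u s < index v s)%N -> e u v = T (index v s)) ->
      v \notin S -> (forall w, w \in S -> e v w = b) ->
      exists s : seq 'I_k, [/\ uniq s, v |: S =i s &
        exists T : pred nat, forall u v, v \in s -> (index u s < index v s)%N ->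
        e u v = T (index v s)].
    move=> us Ss Ts vS ev; exists (rcons s v); split.
    - by rewrite rcons_uniq -Ss vS.
    - by move=> x; rewrite in_setU1 mem_rcons inE Ss.
    exists (fun n => if n == size s then b else T n) => x y.
    rewrite mem_rcons inE -cats1 !index_cat -!Ss.
    have [->|yv /= yS] := eqVneq y v.
      move=> _; rewrite (negbTE vS) /= eqxx addn0 eqxx.
      case: ifP => [xS _|_]; first by rewrite esym ev.
      by rewrite ltnNge leq_addr.
    rewrite yS; have ys : (index y s < size s)%N by rewrite index_mem -Ss.
    case: ifP => [xS xy|_]; last by rewrite ltnNge (leq_trans (ltnW ys)) ?leq_addr.
    by rewrite (ltn_eqF ys) Ts // -Ss.
  elim: thr => [v|S v _ [s [us Ss [T Ts]]] vS ev|S v _ [s [us Ss [T Ts]]] vS ev].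
  - exists [:: v]; split=> // [x|]; first by rewrite !inE.
    exists xpred0 => u w; rewrite inE => /eqP -> /=; rewrite eqxx ltn0 //.
  - apply: (step S v s T false) => // w wS; exact/negbTE/ev.
  - apply: (step S v s T true) => // w wS; exact: ev.
have szs : size s = k.
  by rewrite -(card_uniqP us) -(eq_card sall) cardsT card_ord.
have ltk u : (index u s < k)%N by rewrite -{2}szs index_mem -sall inE.
exists (fun u => Ordinal (ltk u)), (fun n => (n < k)%N && T n); split.
- move=> u v [] /(congr1 (nth u s)).
  by rewrite !nth_index // -sall inE.
- by move=> n /andP[].
- by move=> u v /= uv; rewrite ltk (Ts u v) // -sall inE.
Qed.

Lemma sum_pos (V : nmodType) (k : nat) (pos : 'I_k -> 'I_k) (F : nat -> V) :
  injective pos -> \sum_u F (pos u) = \sum_(0 <= m < k) F m.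
Proof. by move=> pi; rewrite big_mkord [RHS](reindex_inj pi). Qed.

(** The vertex [u] sees the earlier positions if its own type is dominating,
    and a later position if the type there is. *)
Lemma sum_neighbours (R : nzRingType) (k : nat) (e : rel 'I_k) pos T (F : nat -> R) u :
  simple_graph e -> construction_order e pos T ->
  \sum_v (e u v)%:R * F (pos v) =
  (T (pos u))%:R * (\sum_(0 <= m < pos u) F m) +
  \sum_((pos u).+1 <= m < k) (T m)%:R * F m.
Proof.
move=> [esym eirr] [pi Tk eT].
pose G m := if (m < pos u)%N then (T (pos u))%:R * F m
            else if (pos u < m)%N then (T m)%:R * F m else 0.
rewrite (eq_bigr (fun v => G (pos v))) => [|v _]; last first.
  rewrite /G; case: ltngtP => [vu|uv|/val_inj/pi ->].
  - by rewrite esym eT.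
  - by rewrite eT.
  - by rewrite eirr mul0r.
rewrite sum_pos // (big_cat_nat (n := pos u)) //=; last exact: ltnW.
rewrite mulr_sumr; congr (_ + _).
  by apply: eq_big_nat => m /andP[_ mu]; rewrite /G mu.
rewrite big_ltn // {1}/G ltnn add0r; apply: eq_big_nat => m /andP[um _].
by rewrite /G ltnNge (ltnW um) um.
Qed.

Lemma degree_sum (R : nzRingType) (k : nat) (e : rel 'I_k) u :
  \sum_v (e u v)%:R = (degree e u)%:R :> R.
Proof.
rewrite -natr_sum /degree -sum1_card [in RHS]big_mkcond; congr _%:R.
by apply: eq_bigr => v _; rewrite inE; case: (e u v).
Qed.

Lemma degreeE (k : nat) (e : rel 'I_k) pos T u :
  simple_graph e -> construction_order e pos T ->
  degree e u = pos_degree k T (pos u).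
Proof.
move=> es o; apply/eqP; rewrite -(eqr_nat int) -degree_sum.
have := sum_neighbours (fun=> 1 : int) u es o.
rewrite sumr_const_nat subn0 => E.
rewrite (eq_bigr (fun v => (e u v)%:R * 1)) => [|v _]; last by rewrite mulr1.
rewrite E /pos_degree natrD natrM /dominating_after natr_sum; apply/eqP; congr (_ * _ + _).
by apply: eq_bigr => m _; rewrite mulr1.
Qed.

(** Orthogonal vectors: 1 on the first [n] positions, [- n] at position [n]. *)
Definition mode (R : nzRingType) (n m : nat) : R :=
  if (m < n)%N then 1 else if m == n then - n%:R else 0.

Lemma sum_mode (R : nzRingType) n p :
  \sum_(0 <= m < p) mode R n m = if (n < p)%N then 0 else p%:R.
Proof.
elim: p => [|p IHp]; first by rewrite big_geq.
rewrite big_nat_recr //= IHp /mode ltnS.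
have [np|pn|->] := ltngtP n p; first by rewrite addr0.
  by rewrite -natr1.
by rewrite addrN.
Qed.

Lemma laplacian_row (R : realType) (k : nat) (e : rel 'I_k) (x : 'rV[R]_k) u :
  simple_graph e ->
  (x *m laplacian R e) 0 u = \sum_v (e u v)%:R * (x 0 u - x 0 v).
Proof.
move=> [esym eirr]; rewrite /laplacian mulmxBr mul_mx_diag !mxE.
under [RHS]eq_bigr do rewrite mulrBr.
rewrite big_split /= -sumrN; congr (_ + _); last first.
  by apply: eq_bigr => v _; rewrite mxE esym mulrC.
by rewrite -mulr_suml degree_sum mulrC.
Qed.

(** Row [i] is the mode with [n = i + 1], so that [n] runs from 1 to [k] and
    the last row is constant. *)
Definition mode_mx (R : realType) (k : nat) (pos : 'I_k -> 'I_k) : 'M[R]_k :=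
  \matrix_(i, u) mode R i.+1 (pos u).

Definition mode_eigenvalues (R : realType) (k : nat) (T : pred nat) : 'rV[R]_k :=
  \row_i (pos_eigenvalue k T i.+1)%:R.

(** At the vertex of position [p], the Laplacian sums the differences with the
    neighbours.  For [p < n], only position [n] and the later dominating
    vertices differ from the entry 1; for [p = n], all neighbours contribute;
    for [p > n], the entry is 0 and the earlier ones have zero sum. *)
Lemma mode_laplacian (R : realType) (k : nat) (e : rel 'I_k) pos T :
  simple_graph e -> construction_order e pos T ->
  mode_mx R pos *m laplacian R e =
  diag_mx (mode_eigenvalues R k T) *m mode_mx R pos.
Proof.
move=> es o; have [_ Tk _] := o; apply/row_matrixP => i; apply/rowP => u.
rewrite row_mul laplacian_row // mul_diag_mx !mxE.
set n := i.+1; have nk : (n <= k)%N by exact: ltn_ord.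
rewrite (eq_bigr (fun v => (e u v)%:R * (mode R n (pos u) - mode R n (pos v)))); last first.
  by move=> v _; rewrite !mxE.
rewrite (sum_neighbours (fun m => mode R n (pos u) - mode R n m) u es o).
move: (pos u) (ltn_ord (pos u)) => p pk.
rewrite sumrB sum_mode sumr_const_nat subn0.
have late m : (n < m)%N -> mode R n m = 0.
  by move=> nm; rewrite /mode ltnNge ltnW //= gtn_eqF.
rewrite /pos_eigenvalue /dominating_after natrD natrM natr_sum.
have [pn|np|pn] := ltngtP p n.
- rewrite {1}/mode pn subrr mulr0 add0r.
  rewrite (@big_cat_nat _ _ _ n) //= big_nat big1 => [|m /andP[_ mn]]; last first.
    by rewrite /mode pn mn subrr mulr0.
  rewrite add0r [in RHS]/mode pn mulr1.
  have [nk'|kn] := ltnP n k; last first.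
    rewrite !big_geq ?addr0 //; last exact: leqW.
    by case: (boolP (T n)) => [/Tk|_]; [rewrite ltnNge kn | rewrite mul0r].
  rewrite big_ltn //; congr (_ + _).
    by rewrite /mode pn ltnn eqxx opprK -[n.+1]addn1 natrD addrC.
  by apply: eq_big_nat => m /andP[nm _]; rewrite [mode R n m]late // /mode pn subr0 mulr1.
- rewrite (late _ np) mul0rn subrr mulr0 add0r mulr0.
  rewrite big_nat big1 // => m /andP[pm _].
  by rewrite !late ?subrr ?mulr0 // (ltn_trans np).
- rewrite pn {1}/mode ltnn eqxx -[in RHS]/n.
  have -> : mode R n n = - n%:R by rewrite /mode ltnn eqxx.
  rewrite mulrDl; congr (_ + _).
    by rewrite -mulr_natr -(natr1 n); ring.
  rewrite mulr_suml; apply: eq_big_nat => m /andP[nm _].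
  by rewrite [mode R n m]late // subr0.
Qed.

(** The rows are nonzero and pairwise orthogonal: on the support of a mode, any
    later one is constant, and the former has zero sum. *)
Lemma mode_mx_unit (R : realType) (k : nat) (pos : 'I_k -> 'I_k) :
  injective pos -> mode_mx R pos \in unitmx.
Proof.
move=> pi.
(* the squared norms of the modes, making up the Gram matrix *)
pose c : 'rV[R]_k := \row_i \sum_(0 <= m < k) mode R i.+1 m ^+ 2.
have dotE i j : (mode_mx R pos *m (mode_mx R pos)^T) i j =
    \sum_(0 <= m < k) mode R i.+1 m * mode R j.+1 m.
  rewrite -(sum_pos (fun m => mode R i.+1 m * mode R j.+1 m) pi) mxE.
  by apply: eq_bigr => u _; rewrite !mxE.
have dot0 (i j : 'I_k) : (i < j)%N ->
    \sum_(0 <= m < k) mode R i.+1 m * mode R j.+1 m = 0.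
  move=> ij; have ik : (i.+1 < k)%N by apply: leq_ltn_trans (ltn_ord j).
  have h := sum_mode R i.+1 k; rewrite ik in h; rewrite -[RHS]h; apply: eq_bigr => m _.
  have [mi|im] := leqP m i.+1.
    by rewrite [mode R j.+1 m]/mode ltnS (leq_trans mi) ?mulr1.
  by rewrite /mode ltnNge (ltnW im) /= gtn_eqF ?mul0r.
have gram : mode_mx R pos *m (mode_mx R pos)^T = diag_mx c.
  apply/matrixP => i j; rewrite dotE !mxE; have [ij|ji|/val_inj ->] := ltngtP i j.
  - by rewrite dot0 // -val_eqE /= ltn_eqF.
  - by under eq_bigr do rewrite mulrC; rewrite dot0 // -val_eqE /= gtn_eqF.
  by rewrite eqxx mulr1n; apply: eq_bigr => m _; rewrite expr2.
have c0 i : c 0 i != 0.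
  rewrite mxE big_ltn ?(leq_trans _ (ltn_ord i)) // gt_eqF //.
  rewrite ltr_wpDr ?sumr_ge0 // => [m _|]; first exact: sqr_ge0.
  by rewrite /mode expr1n.
have [] := @mulmx1_unit _ _ (mode_mx R pos)
             ((mode_mx R pos)^T *m diag_mx (\row_i (c 0 i)^-1)) => //.
rewrite mulmxA gram mulmx_diag; apply/matrixP => i j; rewrite !mxE.
by case: eqP => // _; rewrite !mulr1n mulfV //; have := c0 i; rewrite mxE.
Qed.

(** * Eigenvectors annihilated by the input matrix *)

Lemma pos_surj (k : nat) (pos : 'I_k -> 'I_k) n :
  injective pos -> (n < k)%N -> exists u, pos u = n :> nat.
Proof. by move=> pi nk; exists (invF pi (Ordinal nk)); rewrite f_invF. Qed.

(** Otherwise the last vertex would be isolated. *)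
Lemma connected_last_dominating (k : nat) (e : rel 'I_k) pos T :
  (2 <= k)%N -> simple_graph e -> graph_connected e -> construction_order e pos T ->
  T k.-1.
Proof.
move=> k2 [esym eirr] conn [pi Tk eT]; apply: contraT => /negbTE Tl.
have [u pu] : exists u, pos u = k.-1 :> nat by apply: pos_surj => //; lia.
have [v pv] : exists v, pos v = 0%N :> nat by apply: pos_surj => //; lia.
have iso w : e u w = false.
  have [->|wu] := eqVneq w u; first exact: eirr.
  rewrite esym eT pu // ltn_neqAle -pu -ltnS pu prednK ?ltn_ord ?andbT; last by lia.
  by apply: contra wu => /eqP h; apply/eqP/pi/val_inj; rewrite /= h pu.
have /connectP[[|w p] /=] := conn u v; last by rewrite iso.
by move=> _ vu; move: pv; rewrite vu pu; lia.
Qed.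

(** An eigenvector only involves the modes of its own eigenvalue. *)
Lemma eigenvector_expansion (R : fieldType) (k : nat) (W L : 'M[R]_k) (mu : 'rV[R]_k)
    (a : R) (v : 'rV[R]_k) :
  W \in unitmx -> W *m L = diag_mx mu *m W -> v *m L = a *: v ->
  exists2 z : 'rV[R]_k, v = z *m W & forall i, z 0 i != 0 -> mu 0 i = a.
Proof.
move=> uW WL vL; exists (v *m invmx W) => [|i]; first by rewrite mulmxKV.
set z := v *m _ => zi.
have : z *m diag_mx mu = a *: z.
  have -> : diag_mx mu = W *m L *m invmx W by rewrite WL mulmxK.
  by rewrite /z !mulmxA mulmxKV // vL scalemxAl.
move/rowP/(_ i); rewrite mul_mx_diag mxE [RHS]mxE mulrC; exact: (mulIf zi).
Qed.

(** [n] is the first index whose eigenvalue is [a].  All modes involved in [v]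
    are constant before [n]; they have zero sum unless their index is [k]; and
    their supports end within the run of [n].  The last type is dominating, so
    the run of [k] is reduced to [k]: for [n < k] no constant mode occurs. *)
Lemma eigenvector_shape (R : realType) (k : nat) (e : rel 'I_k) pos T
    (a : R) (v : 'rV[R]_k) :
  simple_graph e -> construction_order e pos T -> T k.-1 ->
  v *m laplacian R e = a *: v -> v != 0 ->
  exists n, [/\ (0 < n <= k)%N,
    forall u w : 'I_k, (pos u < n)%N -> (pos w < n)%N -> v 0 u = v 0 w,
    (n < k)%N -> \sum_u v 0 u = 0 &
    forall u, (n <= pos u)%N -> v 0 u != 0 ->
      pos_eigenvalue k T (pos u) = pos_eigenvalue k T n /\
      pos_degree k T (pos u) = pos_degree k T n].
Proof.
move=> es o Tl vL v0; have [pi Tk _] := o.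
have [z vE zmu] := eigenvector_expansion (mode_mx_unit R pi) (mode_laplacian R es o) vL.
have {}zmu i : z 0 i != 0 -> (pos_eigenvalue k T i.+1)%:R = a.
  by move/zmu; rewrite mxE.
have vuE u : v 0 u = \sum_i z 0 i * mode R i.+1 (pos u).
  by rewrite vE mxE; apply: eq_bigr => i _; rewrite !mxE.
pose P n := (0 < n <= k)%N && ((pos_eigenvalue k T n)%:R == a).
have exP : exists n, P n.
  have /rV0Pn[i zi] : z != 0 by apply: contra_neq v0; rewrite vE => ->; rewrite mul0mx.
  by exists i.+1; rewrite /P ltn_ord (zmu _ zi) eqxx.
case: (ex_minnP exP) => n /andP[nk /eqP na] nmin.
have ni i : z 0 i != 0 -> (n <= i.+1)%N.
  by move=> zi; apply: nmin; rewrite /P ltn_ord (zmu _ zi) eqxx.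
have eqn i : z 0 i != 0 -> pos_eigenvalue k T n = pos_eigenvalue k T i.+1.
  by move=> zi; apply/eqP; rewrite -(eqr_nat R) na (zmu _ zi).
exists n; split=> //.
- have vc u : (pos u < n)%N -> v 0 u = \sum_i z 0 i.
    move=> un; rewrite vuE; apply: eq_bigr => i _.
    have [->|/ni ii] := eqVneq (z 0 i) 0; first by rewrite mul0r.
    by rewrite /mode (leq_trans un ii) mulr1.
  by move=> u w /vc -> /vc ->.
- move=> nk'; under eq_bigr do rewrite vuE.
  rewrite exchange_big big1 // => i _ /=; rewrite -mulr_sumr.
  have [->|zi] := eqVneq (z 0 i) 0; first by rewrite mul0r.
  rewrite (sum_pos (fun m => mode R i.+1 m) pi) sum_mode; case: ltnP => [|ki].
    by rewrite mulr0.
  have ik : i.+1 = k by apply/eqP; rewrite eqn_leq ki ltn_ord.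
  have := eqn i zi; rewrite ik => E.
  (* the run would contain [k - 1], which is dominating, and [k], which is not *)
  have Tkk : T k = false by apply/negP => /Tk; rewrite ltnn.
  have := pos_eigenvalue_run Tk E (l := k); rewrite Tkk leqnn (ltnW nk') => /(_ isT).
  have := pos_eigenvalue_run Tk E (l := k.-1); rewrite Tl leq_pred andbT.
  have -> : (n <= k.-1)%N by case: (k) nk'.
  by move=> /(_ isT) <-.
- move=> u nu; rewrite vuE => /eqP su.
  have [i zi ui] : exists2 i, z 0 i != 0 & (pos u <= i.+1)%N.
    apply/exists_inP; apply: contra_notT su; rewrite negb_exists_in => /forall_inP h.
    rewrite big1 // => i _; have [->|/h] := eqVneq (z 0 i) 0; first by rewrite mul0r.
    by rewrite -ltnNge => iu; rewrite /mode ltnNge (ltnW iu) /= gtn_eqF ?mulr0.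
  by apply: (pos_eigenvalue_between Tk (eqn i zi)); rewrite nu.
Qed.

(** The first two vertices have the same degree, so [v] vanishes at one of
    them, hence everywhere before [n] if [n > 1].  What remains lies in the
    degree class of position [n], so on a single vertex, and has zero sum; for
    [n = k] nothing remains. *)
Lemma eigenvector_on_representatives_eq0 (R : realType) (k : nat) (e : rel 'I_k) pos T
    (a : R) (v : 'rV[R]_k) :
  (2 <= k)%N -> simple_graph e -> construction_order e pos T -> T k.-1 ->
  v *m laplacian R e = a *: v ->
  (forall u w, v 0 u != 0 -> v 0 w != 0 -> degree e u = degree e w -> u = w) ->
  v = 0.
Proof.
move=> k2 es o Tl vL vinj; have [pi Tk _] := o; apply: contraTeq isT => v0.
have [u0 p0] : exists u, pos u = 0%N :> nat by apply: pos_surj => //; lia.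
have [u1 p1] : exists u, pos u = 1%N :> nat by apply: pos_surj => //; lia.
have [n [/andP[n0 nk] vc vs vd]] := eigenvector_shape es o Tl vL v0.
have vn u : v 0 u != 0 -> (pos u < n)%N -> n = 1%N.
  move=> vu un; apply/eqP; rewrite eqn_leq n0 andbT leqNgt; apply/negP => n1.
  have v0u : v 0 u0 != 0 by rewrite (vc u0 u) ?p0.
  have v1u : v 0 u1 != 0 by rewrite (vc u1 u) ?p1.
  have /(congr1 (fun u => nat_of_ord (pos u))) : u0 = u1; last by rewrite p0 p1.
  by apply: vinj => //; rewrite !(degreeE _ es o) p0 p1 pos_degree01.
have vdeg u : v 0 u != 0 -> degree e u = pos_degree k T n.
  move=> vu; rewrite (degreeE _ es o); have [un|nu] := ltnP (pos u) n; last first.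
    by have [] := vd u nu vu.
  have n1 := vn u vu un; move: un; rewrite n1 ltnS leqn0 => /eqP ->.
  exact: pos_degree01.
have /rV0Pn[r vr] := v0.
have vr0 u : u != r -> v 0 u = 0.
  by apply: contraNeq => vu; apply/eqP/vinj; rewrite // !vdeg.
have nk' : (n < k)%N.
  rewrite ltn_neqAle nk andbT; apply/eqP => nk'.
  by have := vn r vr; rewrite {1}nk' ltn_ord => /(_ isT); lia.
by have := vs nk'; rewrite (bigD1 r) //= big1 // addr0 => /eqP; rewrite (negbTE vr).
Qed.

(** With unit vectors in all rows, the columns would sum to the constant vector,
    on which every zero-sum eigenvector vanishes, so that one equation would be
    lost; the zero row at the first vertex restores it. *)
Definition unit_rows_mx (R : realType) (k p : nat) (pos : 'I_k -> 'I_k)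
    (f : 'I_k -> nat) : 'M[R]_(k, p) :=
  \matrix_(u, j) ((0 < pos u)%N && (f u == j))%:R.

(** Summing the entries of [v *m unit_rows_mx R p pos f] shows that the entries
    of [v] off the first vertex sum to zero.  Together with the total sum, or with constancy,
    this makes the first entry vanish, hence all those before [n]; what remains
    lies in one eigenvalue class, where [f] is injective. *)
Lemma eigenvector_unit_rows_eq0 (R : realType) (k p : nat) (e : rel 'I_k) pos T
    (f : 'I_k -> nat) (a : R) (v : 'rV[R]_k) :
  (2 <= k)%N -> simple_graph e -> construction_order e pos T -> T k.-1 ->
  (forall u, (0 < pos u)%N -> (f u < p)%N) ->
  (forall u w, (0 < pos u)%N -> (0 < pos w)%N ->
     pos_eigenvalue k T (pos u) = pos_eigenvalue k T (pos w) -> f u = f w -> u = w) ->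
  v *m laplacian R e = a *: v ->
  v *m unit_rows_mx R p pos f = 0 -> v = 0.
Proof.
move=> k2 es o Tl fp finj vL vB; have [pi Tk _] := o; apply: contraTeq isT => v0.
have col (j : 'I_p) : \sum_(u | (0 < pos u)%N && (f u == j)) v 0 u = 0.
  have /rowP/(_ j) := vB; rewrite [RHS]mxE => h.
  by rewrite -[RHS]h mxE big_mkcond; apply: eq_bigr => u _; rewrite mxE mulr_natr mulrb.
have [u0 p0] : exists u, pos u = 0%N :> nat by apply: pos_surj => //; lia.
have pos0 u : (0 < pos u)%N = (u != u0).
  by rewrite lt0n -p0 (inj_eq val_inj) (inj_eq pi).
have sum_rest : \sum_(u | u != u0) v 0 u = 0.
  transitivity (\sum_(j < p) \sum_(u | (0 < pos u)%N && (f u == j)) v 0 u); last first.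
    by rewrite big1.
  rewrite (exchange_big_dep (fun u => u != u0)) /= => [|j u _]; last first.
    by rewrite pos0 => /andP[].
  apply: eq_bigr => u; rewrite -pos0 => pu.
  rewrite (big_pred1 (Ordinal (fp u pu))) // => j.
  by rewrite pu /= [LHS]eq_sym.
have [n [/andP[n0 nk] vc vs vd]] := eigenvector_shape es o Tl vL v0.
have vu0 : v 0 u0 = 0.
  move: nk; rewrite leq_eqVlt => /predU1P[nk|/vs]; last first.
    by rewrite (bigD1 u0) //= sum_rest addr0.
  move: sum_rest; rewrite (eq_bigr (fun=> v 0 u0)) => [|u _]; last first.
    by apply: vc; rewrite nk.
  rewrite sumr_const => /eqP; rewrite mulrn_eq0 => /orP[|/eqP //].
  by have := cardC (pred1 u0); rewrite card1 card_ord => h /eqP h'; move: h; rewrite h'; lia.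
have vn u : v 0 u != 0 -> (n <= pos u)%N.
  by apply: contraR; rewrite -ltnNge => un; rewrite (vc u u0) ?vu0 // p0.
have /rV0Pn[r vr] := v0; have rn := vn r vr.
have r0 : (0 < pos r)%N by exact: leq_trans rn.
have := col (Ordinal (fp r r0)); rewrite (bigD1 r) /= ?r0 ?eqxx //.
rewrite big1 ?addr0 => [/eqP|u]; first by rewrite (negbTE vr).
case/andP=> /andP[u0' /eqP fur]; apply: contraNeq => vu; apply/eqP/finj => //.
by have [-> _] := vd u (vn u vu) vu; have [-> _] := vd r rn vr.
Qed.

(** Of two vertices of a threshold graph, one has all the outer neighbours of
    the other, according to the type of the later one; with equal degrees these
    neighbourhoods coincide. *)
Lemma degree_twins (k : nat) (e : rel 'I_k) pos T u v w :
  simple_graph e -> construction_order e pos T ->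
  degree e u = degree e v -> w != u -> w != v -> e u w = e v w.
Proof.
move=> [esym eirr] [pi Tk eT].
wlog uv : u v / (pos u < pos v)%N => [hw d wu wv|].
  have [uv|vu|/val_inj/pi ->//] := ltngtP (pos u) (pos v); first exact: hw.
  by symmetry; apply: hw.
move=> d wu wv.
pose N x := [set y | [&& y != u, y != v & e x y]].
have dN x : x = u \/ x = v -> degree e x = (#|N x| + e u v)%N.
  move=> xuv; have vu : (v == u) = false by apply: contraTF uv => /eqP ->; rewrite ltnn.
  (* [y] is the other one of [u] and [v] *)
  have [y [xy yE]] : exists y, e x y = e u v /\
      forall z, (z != y) && e x z = [&& z != u, z != v & e x z].
    case: xuv => ->; [exists v | exists u]; split=> // z.
      by case: (eqVneq z u) => [->|]; rewrite ?eirr ?andbF.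
    by case: (eqVneq z v) => [->|]; rewrite ?eirr ?andbF.
  rewrite /degree (cardsD1 y) addnC inE xy; congr (_ + _)%N.
  by apply: eq_card => z; rewrite !inE yE.
have cN : #|N u| = #|N v|.
  by apply/(@addIn (e u v)); rewrite -(dN u) ?(dN v); auto; rewrite -(dN v) //; right.
have NE : N u = N v.
  have after z : (pos v < pos z)%N -> e u z = e v z.
    by move=> vz; rewrite !eT // (ltn_trans uv).
  case: (boolP (T (pos v))) => Tv; [|symmetry]; apply/eqP; rewrite eqEcard cN leqnn andbT;
    apply/fintype.subsetP => z; rewrite !inE => /and3P[-> zv]; rewrite zv /=.
    have [zv'|vz|/val_inj/pi zv'] := ltngtP (pos z) (pos v); last by rewrite zv' eqxx in zv.
      by rewrite [e v z]esym (eT z v) ?Tv.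
    by rewrite (after z).
  have [zv'|vz|/val_inj/pi zv'] := ltngtP (pos z) (pos v); last by rewrite zv' eqxx in zv.
    by rewrite [e v z]esym (eT z v) ?(negbTE Tv).
  by rewrite (after z).
by have /setP/(_ w) := NE; rewrite !inE wu wv.
Qed.

(** * Twin vertices and lower bounds *)

(** By twinship the adjacency is constant, equal to some [b], within a degree
    class, and constant from any outer vertex to the class.  So a zero-sum
    vector on the class is multiplied by the degree plus [b]. *)
Lemma degree_class_eigenvector (R : realType) (k : nat) (e : rel 'I_k) pos T
    (delta : nat) (v : 'rV[R]_k) :
  simple_graph e -> construction_order e pos T ->
  (forall u, v 0 u != 0 -> degree e u = delta) -> \sum_u v 0 u = 0 ->
  exists a, v *m laplacian R e = a *: v.
Proof.
move=> es o vC v0; have [esym eirr] := es.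
have tw x y z : degree e x = degree e y -> z != x -> z != y -> e x z = e y z.
  exact: (degree_twins es o).
have const u w u' w' : degree e u = delta -> degree e w = delta -> u != w ->
    degree e u' = delta -> degree e w' = delta -> u' != w' -> e u w = e u' w'.
  move=> du dw uw du' dw' uw'; have [wu'|wu'] := eqVneq w u'.
    by rewrite wu' in uw *; rewrite [RHS]esym; apply: tw; rewrite ?du ?dw' // eq_sym.
  rewrite (tw u u') ?du ?du' // 1?eq_sym // esym [RHS]esym.
  by apply: tw; rewrite ?dw ?dw' // eq_sym.
have [b eb] : exists b : bool, forall u w, degree e u = delta -> degree e w = delta ->
    u != w -> e u w = b.
  have [/existsP[u /existsP[w /and4P[/eqP du /eqP dw uw euw]]]|none] :=
    boolP [exists u, exists w,
             [&& degree e u == delta, degree e w == delta, u != w & e u w]].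
    by exists true => x y dx dy xy; rewrite (const x y u w).
  exists false => u w du dw uw; apply: contraNF none => euw.
  by apply/existsP; exists u; apply/existsP; exists w; rewrite du dw uw euw eqxx.
exists (delta%:R + b%:R); apply/rowP => u; rewrite laplacian_row // [RHS]mxE.
under eq_bigr do rewrite mulrBr.
rewrite sumrB -mulr_suml degree_sum mulrDl.
have [du|du] := eqVneq (degree e u) delta.
  rewrite du; congr (_ + _); rewrite (bigD1 u) //= eirr mul0r add0r.
  rewrite (eq_bigr (fun w => b%:R * v 0 w)) => [|w wu].
    rewrite -mulr_sumr -mulrN; congr (_ * _); symmetry; apply/eqP.
    by rewrite -addr_eq0; move: v0; rewrite (bigD1 u) //= => ->.
  have [->|/vC dw] := eqVneq (v 0 w) 0; first by rewrite !mulr0.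
  by rewrite (eb u w) // eq_sym.
have vu : v 0 u = 0 by apply: contra_neq_eq du => /vC.
rewrite vu !mulr0 add0r addr0; apply/eqP; rewrite oppr_eq0; apply/eqP.
have [->|/rV0Pn[x vx]] := eqVneq v 0.
  by rewrite big1 // => w _; rewrite mxE mulr0.
rewrite (eq_bigr (fun w => (e x u)%:R * v 0 w)) => [|w _].
  by rewrite -mulr_sumr v0 mulr0.
have [->|vw] := eqVneq (v 0 w) 0; first by rewrite !mulr0.
rewrite esym (tw w x) //; first by rewrite !vC.
  by apply: contra_neq vw => <-.
by apply: contra_neq vx => <-.
Qed.

Lemma left_kernel_vector (F : fieldType) (m n : nat) (A : 'M[F]_(m, n)) :
  (\rank A < m)%N -> exists2 z : 'rV[F]_m, z != 0 & z *m A = 0.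
Proof.
move=> rA; have : kermx A != 0 by rewrite kermx_eq0 /row_free ltn_eqF.
move=> kA; exists (nz_row (kermx A)); first by rewrite nz_row_eq0.
by apply/sub_kermxP; exact: nz_row_sub.
Qed.

Lemma zero_row_rank (F : fieldType) (m n : nat) (A : 'M[F]_(m, n)) i :
  row i A = 0 -> (\rank A < m)%N.
Proof.
move=> Ai; rewrite ltn_neqAle rank_leq_row andbT; apply/negP => fA.
have /(row_free_inj fA) : delta_mx 0 i *m A = (0 : 'rV_m) *m A by rewrite -rowE Ai mul0mx.
by move/matrixP/(_ 0 i); rewrite !mxE !eqxx => /eqP; rewrite oner_eq0.
Qed.

(** If the rank were smaller, appending a column of ones would still leave a
    nonzero left kernel; its elements, extended by zero, are zero-sum vectors
    on the degree class that [B] annihilates. *)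
Lemma controllable_class_rank (R : realType) (k p : nat) (e : rel 'I_k) pos T
    (B : 'M[R]_(k, p)) (A : {set 'I_k}) (delta : nat) :
  simple_graph e -> construction_order e pos T ->
  controllable (laplacian R e) B -> (forall u, u \in A -> degree e u = delta) ->
  (#|A| - 1 <= \rank (rowsub (enum_val : 'I_#|A| -> 'I_k) B))%N.
Proof.
move=> es o ctrl Ad; set f := (enum_val : 'I_#|A| -> 'I_k).
rewrite leqNgt; apply/negP => small.
have [|z z0] := @left_kernel_vector _ _ _ (row_mx (rowsub f B) (const_mx 1 : 'cV_#|A|)).
  rewrite -mxrank_tr tr_row_mx -addsmxE.
  have := mxrank_adds_leqif (rowsub f B)^T (const_mx 1 : 'cV[R]_#|A|)^T.
  rewrite mxrank_tr => -[+ _]; move/leq_ltn_trans; apply.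
  have := rank_leq_row (const_mx 1 : 'cV[R]_#|A|)^T; lia.
rewrite mul_mx_row -[RHS](row_mx0 R 1 p 1) => /eq_row_mx[zB zs].
pose v := z *m rowsub f 1%:M.
have vE u : v 0 u = \sum_i z 0 i * (f i == u)%:R.
  by rewrite mxE; apply: eq_bigr => i _; rewrite !mxE.
have vA u : v 0 u != 0 -> degree e u = delta.
  move=> vu; apply: Ad; apply: contraR vu => uA; rewrite vE big1 // => i _.
  by case: eqP => [iu|]; rewrite ?mulr0 //; move: (enum_valP i); rewrite -/f iu (negbTE uA).
have vs : \sum_u v 0 u = 0.
  under eq_bigr do rewrite vE.
  rewrite exchange_big /=; move/matrixP/(_ 0 0): zs; rewrite !mxE => zs.
  rewrite -[RHS]zs; apply: eq_bigr => i _; rewrite -mulr_sumr mxE; congr (_ * _).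
  rewrite (bigD1 (f i)) //= eqxx big1 ?addr0 // => u ui.
  by rewrite eq_sym (negbTE ui).
have [a va] := degree_class_eigenvector es o vA vs.
have vB : v *m B = 0 by rewrite -mulmxA mul_rowsub_mx mul1mx.
have := controllable_left_eigenvector ctrl va vB.
apply/eqP; have /rV0Pn[i zi] := z0; apply/rV0Pn; exists (f i).
rewrite vE (bigD1 i) //= eqxx mulr1 big1 ?addr0 // => j ji.
by rewrite (inj_eq enum_val_inj) (negbTE ji) mulr0.
Qed.

(** The difference of two coordinate vectors on a degree class is an
    eigenvector. *)
Lemma controllable_twin_rows (R : realType) (k p : nat) (e : rel 'I_k) pos T
    (B : 'M[R]_(k, p)) u w :
  simple_graph e -> construction_order e pos T ->
  controllable (laplacian R e) B -> row u B = 0 -> row w B = 0 ->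
  degree e u = degree e w -> u = w.
Proof.
move=> es o ctrl Bu Bw duw; apply/eqP; apply: contraT => uw.
pose v : 'rV[R]_k := delta_mx 0 u - delta_mx 0 w.
have vE x : v 0 x = (x == u)%:R - (x == w)%:R by rewrite !mxE.
have vd x : v 0 x != 0 -> degree e x = degree e u.
  rewrite vE; have [->//|xu] := eqVneq x u; have [->//|xw] := eqVneq x w.
  by rewrite subrr eqxx.
have vs : \sum_x v 0 x = 0.
  under eq_bigr do rewrite vE.
  have one y : \sum_x (x == y)%:R = 1 :> R.
    by rewrite (bigD1 y) //= eqxx big1 ?addr0 // => x /negbTE ->.
  by rewrite sumrB !one subrr.
have [a va] := degree_class_eigenvector es o vd vs.
have vB : v *m B = 0 by rewrite mulmxBl -!rowE Bu Bw subrr.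
have /rowP/(_ u) := controllable_left_eigenvector ctrl va vB.
by rewrite vE mxE eqxx (negbTE uw) subr0 => /eqP; rewrite oner_eq0.
Qed.

(** The rows of [W] with eigenvalue [a] form a basis of the eigenspace. *)
Lemma rank_eigenspace_modes (F : fieldType) (k : nat) (W L : 'M[F]_k) (mu : 'rV[F]_k) a :
  W \in unitmx -> W *m L = diag_mx mu *m W ->
  \rank (eigenspace L a) = #|[set i | mu 0 i == a]|.
Proof.
move=> uW WL; set A := [set i | _]; set f := (enum_val : 'I_#|A| -> 'I_k).
have free : row_free (rowsub f W).
  have -> : rowsub f W = rowsub f 1%:M *m W by rewrite mul_rowsub_mx mul1mx.
  rewrite /row_free mxrankMfree ?row_free_unit //.
  apply/row_freeP; exists (rowsub f 1%:M)^T; apply/matrixP => i j; rewrite !mxE.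
  rewrite (bigD1 (f i)) //= !mxE eqxx mul1r (inj_eq enum_val_inj) eq_sym.
  by rewrite big1 ?addr0 // => x xi; rewrite !mxE [f i == x]eq_sym (negbTE xi) mul0r.
rewrite -(eqP free); apply/eqP; rewrite eqn_leq; apply/andP; split; apply: mxrankS.
  apply/row_subP => i; have /eigenspaceP := row_sub i (eigenspace L a).
  move=> vL; have [z -> zmu] := eigenvector_expansion uW WL vL.
  rewrite mulmx_sum_row; apply: summx_sub => j _.
  have [->|zj] := eqVneq (z 0 j) 0; first by rewrite scale0r sub0mx.
  apply: scalemx_sub; have jA : j \in A by rewrite inE (zmu _ zj).
  rewrite -(enum_rankK_in jA jA) -/f -row_rowsub; exact: row_sub.
apply/row_subP => i; apply/eigenspaceP; rewrite row_rowsub -row_mul WL.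
apply/rowP => j; rewrite [LHS]mxE mul_diag_mx !mxE.
by have := enum_valP i; rewrite -/f inE => /eqP ->.
Qed.

(** * Degree classes and multiplicities *)

Lemma count_enum_ord (k : nat) (P : pred 'I_k) : count P (enum 'I_k) = #|[set i | P i]|.
Proof.
rewrite -size_filter cardE; apply/perm_size/uniq_perm.
- by rewrite filter_uniq ?enum_uniq.
- exact: enum_uniq.
by move=> i; rewrite mem_filter !mem_enum !inE andbT.
Qed.

Lemma distinct_values_uniq d : uniq (distinct_values d).
Proof. by rewrite sort_uniq undup_uniq. Qed.

Lemma mem_distinct_values d : distinct_values d =i d.
Proof. by move=> x; rewrite mem_sort mem_undup. Qed.

Lemma distinct_values_lt d i j : (i < j < size (distinct_values d))%N ->
  (nth 0%N (distinct_values d) j < nth 0%N (distinct_values d) i)%N.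
Proof.
move=> /andP[ij jd].
have geqT : transitive geq by move=> x y z /= xy yz; exact: leq_trans yz xy.
have geq_total : total geq by move=> x y /=; exact: leq_total.
have srt : sorted geq (distinct_values d) by exact: sort_sorted.
have := sorted_leq_nth geqT (fun x => leqnn x) 0%N srt.
move=> /(_ i j); rewrite !inE (ltn_trans ij jd) jd => /(_ isT isT (ltnW ij)).
rewrite /= leq_eqVlt => /predU1P[|//] /eqP.
by rewrite nth_uniq ?distinct_values_uniq ?(ltn_trans ij) // gtn_eqF.
Qed.

Lemma mbarE d i : (i <= size (distinct_values d))%N ->
  mbar d i = count (mem (take i (distinct_values d))) d.
Proof.
elim: i => [|i IHi] id.
  by rewrite take0 /mbar big_ord0 -(count_pred0 d); apply: eq_count => x; rewrite inE.
rewrite /mbar big_ord_recr /= -/(mbar d i) IHi; last exact: ltnW.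
rewrite /mult (take_nth 0%N) //; set s := take i _; set y := nth _ _ _.
have ys : y \notin s.
  have := distinct_values_uniq d; rewrite -(cat_take_drop i.+1 (distinct_values d)).
  by rewrite cat_uniq (take_nth 0%N) // rcons_uniq => /and3P[/andP[]].
rewrite -[LHS]count_predUI [X in (_ + X)%N](_ : _ = 0%N) ?addn0; last first.
  rewrite -(count_pred0 d); apply: eq_count => x /=.
  by apply/negP => /andP[/= xs /eqP xy]; rewrite xy (negbTE ys) in xs.
by apply: eq_count => x /=; rewrite mem_rcons inE orbC.
Qed.

Lemma mbar_count d i : (i < size (distinct_values d))%N ->
  mbar d i = count (fun x => nth 0 (distinct_values d) i < x)%N d /\
  mbar d i.+1 = count (fun x => nth 0 (distinct_values d) i <= x)%N d.
Proof.
move=> id; rewrite !mbarE //; last exact: ltnW.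
have cmp n x : (n <= size (distinct_values d))%N -> x \in d ->
    (x \in take n (distinct_values d)) = (index x (distinct_values d) < n)%N.
  by move=> nd xd; rewrite in_take_leq.
have ltE x : x \in d -> (nth 0%N (distinct_values d) i < x)%N =
                        (index x (distinct_values d) < i)%N.
  rewrite -mem_distinct_values => xd; have xi := xd; rewrite -index_mem in xi.
  rewrite -{1}(nth_index 0%N xd); case: (ltngtP (index x _) i) => ij.
  - by rewrite distinct_values_lt // ij.
  - by rewrite ltnNge ltnW // distinct_values_lt // ij.
  by rewrite ij ltnn.
split; apply: eq_in_count => x xd /=.
  by rewrite ltE // cmp // ltnW.
rewrite cmp //.
rewrite ltnS [in RHS]leq_eqVlt ltE // [in LHS]leq_eqVlt; congr (_ || _).
rewrite -mem_distinct_values in xd.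
apply/eqP/eqP => [<-|<-]; first by rewrite nth_index.
by rewrite index_uniq ?distinct_values_uniq.
Qed.

Lemma initial_segmentE (k : nat) (P : pred 'I_k) (r : 'I_k) :
  (forall i j : 'I_k, (i <= j)%N -> P j -> P i) -> P r = (r < #|[set i | P i]|)%N.
Proof.
move=> down.
have seg n : (n <= k)%N -> #|[set i : 'I_k | (i < n)%N]| = n.
  move=> nk; rewrite -count_enum_ord -(count_map val (fun m => m < n)%N) val_enum_ord.
  by rewrite -size_filter (filter_iota_ltn 0%N nk) size_iota.
case: (boolP (P r)) => Pr; symmetry; last apply/negbTE; rewrite -?leqNgt.
  rewrite -[r.+1](seg _ (ltn_ord r)); apply/subset_leq_card/fintype.subsetP => i.
  by rewrite !inE ltnS => ir; exact: down Pr.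
rewrite -[X in (_ <= X)%N](seg r) ?(ltnW (ltn_ord r)) //.
apply/subset_leq_card/fintype.subsetP => i; rewrite !inE => Pi.
by rewrite ltnNge; apply: contra Pr => ri; exact: down Pi.
Qed.

Lemma count_degree_seq (k : nat) (e : rel 'I_k) (P : pred nat) :
  count P (degree_seq e) = #|[set r | P (degree e r)]|.
Proof. by rewrite count_map count_enum_ord. Qed.

(** As the degrees are sorted, the vertices of degree above a given value form
    an initial segment, whose length [mbar_count] identifies. *)
Lemma degree_block (k : nat) (e : rel 'I_k) i :
  (forall i j : 'I_k, (i <= j)%N -> (degree e j <= degree e i)%N) ->
  let d := degree_seq e in (i < size (distinct_values d))%N ->
  [set r : 'I_k | (mbar d i <= r < mbar d i.+1)%N] =
  [set r | degree e r == nth 0%N (distinct_values d) i].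
Proof.
move=> srt d id; have [-> ->] := mbar_count id; set y := nth _ _ _.
rewrite !count_degree_seq; apply/setP => r; rewrite !inE leqNgt.
rewrite -(initial_segmentE (P := fun r => y < degree e r)%N) => [|a b ab]; last first.
  by move=> /leq_trans; apply; exact: srt.
rewrite -(initial_segmentE (P := fun r => y <= degree e r)%N) => [|a b ab]; last first.
  by move=> /leq_trans; apply; exact: srt.
by rewrite -leqNgt -eqn_leq.
Qed.

Lemma count_mem_max_mult (d : seq nat) c :
  (count_mem c d <= \max_(i < size (distinct_values d)) mult d i)%N.
Proof.
have [cd|/count_memPn -> //] := boolP (c \in d).
have ci : (index c (distinct_values d) < size (distinct_values d))%N.
  by rewrite index_mem mem_distinct_values.
rewrite -[X in (X <= _)%N](_ : mult d (Ordinal ci) = _); first exact: leq_bigmax.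
by rewrite /mult /= nth_index // mem_distinct_values.
Qed.

Lemma max_mult_attained (d : seq nat) : (0 < size d)%N ->
  exists2 c, c \in d & count_mem c d = (\max_(i < size (distinct_values d)) mult d i)%N.
Proof.
case: d => // x s _; set d := x :: s.
have xd : x \in distinct_values d by rewrite mem_distinct_values mem_head.
have card0 : (0 < #|'I_(size (distinct_values d))|)%N.
  by rewrite card_ord; case: (distinct_values d) xd.
have [i ->] := @bigop.eq_bigmax _ (fun i : 'I__ => mult d i) card0.
exists (nth 0%N (distinct_values d) i) => //.
by rewrite -mem_distinct_values mem_nth.
Qed.

(** The vertex of least index in each degree class. *)
Definition class_reps (k : nat) (e : rel 'I_k) : {set 'I_k} :=
  [set u | [forall w, (degree e w == degree e u) ==> (u <= w)%N]].

Lemma class_reps_inj (k : nat) (e : rel 'I_k) u w :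
  u \in class_reps e -> w \in class_reps e -> degree e u = degree e w -> u = w.
Proof.
rewrite !inE => /forallP/(_ w) + /forallP/(_ u) + uw; rewrite uw eqxx /=.
by move=> ul lu; apply/val_inj/eqP; rewrite eqn_leq ul.
Qed.

Lemma class_reps_exist (k : nat) (e : rel 'I_k) u :
  exists2 r, r \in class_reps e & degree e r = degree e u.
Proof.
case: (@arg_minnP _ u (fun w => degree e w == degree e u) val) => // r /eqP ru rmin.
by exists r => //; rewrite inE; apply/forallP => w; apply/implyP; rewrite ru => /rmin.
Qed.

Lemma inj_degree_card (k : nat) (e : rel 'I_k) (A : {set 'I_k}) :
  {in A &, injective (degree e)} ->
  (#|A| <= size (distinct_values (degree_seq e)))%N.
Proof.
move=> inj; rewrite cardE -(size_map (degree e)); apply: uniq_leq_size.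
  by rewrite map_inj_in_uniq ?enum_uniq // => u w; rewrite !mem_enum; exact: inj.
by move=> _ /mapP[u _ ->]; rewrite mem_distinct_values map_f // mem_enum.
Qed.

Lemma card_class_reps (k : nat) (e : rel 'I_k) :
  #|class_reps e| = size (distinct_values (degree_seq e)).
Proof.
apply/eqP; rewrite eqn_leq inj_degree_card ?andTb; last first.
  by move=> u w; exact: class_reps_inj.
rewrite cardE -(size_map (degree e)); apply: uniq_leq_size (distinct_values_uniq _) _.
move=> x; rewrite mem_distinct_values => /mapP[u _ ->].
by have [r rr <-] := class_reps_exist e u; rewrite map_f // mem_enum.
Qed.

Definition select_mx (R : realType) (k : nat) (S : {set 'I_k}) : 'M[R]_(k, #|S|) :=
  \matrix_(u, j) (u == enum_val j)%:R.

Lemma select_mx_terminal (R : realType) (k : nat) (S : {set 'I_k}) :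
  terminal_mx (select_mx R S).
Proof.
move=> j; rewrite (_ : [set i | _] = [set enum_val j]) ?cards1 //.
by apply/setP => u; rewrite !inE mxE pnatr_eq0; case: (u == _).
Qed.

Lemma row_select_mx (R : realType) (k : nat) (S : {set 'I_k}) u :
  u \notin S -> row u (select_mx R S) = 0.
Proof.
move=> uS; apply/rowP => j; rewrite !mxE; case: eqP => // uj.
by move: uS; rewrite uj enum_valP.
Qed.

Lemma mul_select_mx (R : realType) (k : nat) (S : {set 'I_k}) (v : 'rV[R]_k) u :
  v *m select_mx R S = 0 -> u \in S -> v 0 u = 0.
Proof.
move=> vS uS; move/rowP/(_ (enum_rank_in uS u)): vS; rewrite !mxE (bigD1 u) //=.
rewrite mxE enum_rankK_in // eqxx mulr1 big1 ?addr0 // => w wu.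
by rewrite mxE enum_rankK_in // (negbTE wu) mulr0.
Qed.

Lemma select_nonreps_controllable (R : realType) (k : nat) (e : rel 'I_k) pos T :
  (2 <= k)%N -> simple_graph e -> construction_order e pos T -> T k.-1 ->
  controllable (laplacian R e) (select_mx R (~: class_reps e)).
Proof.
move=> k2 es o Tl; have [pi _ _] := o.
apply: controllable_of_modes (mode_mx_unit R pi) (mode_laplacian R es o) _ => a v va vB.
have supp u : v 0 u != 0 -> u \in class_reps e.
  by apply: contraR => uS; rewrite (mul_select_mx vB) // inE.
by apply: (eigenvector_on_representatives_eq0 k2 es o Tl va) => u w /supp ur /supp; exact: class_reps_inj.
Qed.

(** Two vertices of equal degree cannot both have a zero row, and a terminal
    matrix has at most one nonzero row per column. *)
Lemma controllable_terminal_size (R : realType) (k p : nat) (e : rel 'I_k) pos T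
    (B : 'M[R]_(k, p)) :
  simple_graph e -> construction_order e pos T ->
  controllable (laplacian R e) B -> terminal_mx B ->
  (k - size (distinct_values (degree_seq e)) <= p)%N.
Proof.
move=> es o ctrl term; pose N := [set u | row u B != 0].
have NC : (#|~: N| <= size (distinct_values (degree_seq e)))%N.
  apply: inj_degree_card => u w; rewrite !inE !negbK => /eqP Bu /eqP Bw.
  exact: controllable_twin_rows es o ctrl Bu Bw.
have Np : (#|N| <= p)%N.
  have sub u : u \in N -> exists j, B u j != 0.
    by rewrite inE => /rV0Pn[j]; rewrite mxE => ?; exists j.
  have NS : N \subset \bigcup_(j < p) [set i | B i j != 0].
    apply/fintype.subsetP => u /sub[j uj].
    by apply/finset.bigcupP; exists j; rewrite ?inE.
  apply: leq_trans (subset_leq_card NS) _.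
  rewrite -[X in (_ <= X)%N](card_ord p) -[X in (_ <= X)%N]sum1_card.
  elim/big_rec2: _ => [|j n A _ An]; first by rewrite cards0.
  by rewrite (leq_trans (leq_card_setU _ _)) // term leq_add2l.
have := cardsC N; rewrite card_ord; lia.
Qed.

(** * Optimal input matrices *)

Lemma conjugate_degree_perm (k : nat) (e : rel 'I_k) pos T :
  simple_graph e -> construction_order e pos T ->
  perm_eq (conjugate_seq (degree_seq e)) [seq pos_eigenvalue k T n | n <- iota 1 k].
Proof.
move=> es o; have [pi Tk _] := o.
suff -> : conjugate_seq (degree_seq e) =
    [seq count (fun m => i <= pos_degree k T m)%N (iota 0 k) | i <- iota 1 k].
  exact: conj_perm.
rewrite /conjugate_seq {2}/degree_seq size_map size_enum_ord; apply: eq_map => i.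
rewrite count_degree_seq count_iotaE -sum1_card big_mkcond /=.
rewrite -(sum_pos (fun m => (i <= pos_degree k T m)%N : nat) pi).
by apply: eq_bigr => u _; rewrite inE (degreeE u es o); case: leqP.
Qed.

Lemma rank_eigenspace_laplacian (R : realType) (k : nat) (e : rel 'I_k) pos T (c : nat) :
  simple_graph e -> construction_order e pos T ->
  \rank (eigenspace (laplacian R e) c%:R) =
  count_mem c (conjugate_seq (degree_seq e)).
Proof.
move=> es o; have [pi _ _] := o.
rewrite (rank_eigenspace_modes _ (mode_mx_unit R pi) (mode_laplacian R es o)).
rewrite (permP (conjugate_degree_perm es o)) (iotaDl 1 0) -val_enum_ord.
rewrite 3!count_map count_enum_ord; apply: eq_card => i.
by rewrite !inE mxE eqr_nat /= add1n.
Qed.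

Lemma unit_rows_binary (R : realType) (k p : nat) (pos : 'I_k -> 'I_k) f :
  binary_mx (unit_rows_mx R p pos f).
Proof. by move=> u j; rewrite mxE; case: (_ && _); [right | left]. Qed.

(** The number of earlier indices with the same eigenvalue: it tells apart the
    members of an eigenvalue class and stays below the size of the class. *)
Definition eigenvalue_rank (k : nat) (T : pred nat) (n : nat) : nat :=
  count (fun m => pos_eigenvalue k T m == pos_eigenvalue k T n) (iota 1 n.-1).

Lemma eigenvalue_rank_lt k T m n : (0 < m < n)%N ->
  pos_eigenvalue k T m = pos_eigenvalue k T n ->
  (eigenvalue_rank k T m < eigenvalue_rank k T n)%N.
Proof.
move=> /andP[m0 mn] E; rewrite /eigenvalue_rank E.
have -> : n.-1 = (m.-1 + (n - m))%N by lia.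
rewrite iotaD count_cat -[X in (X < _)%N]addn0 ltn_add2l.
have -> : (n - m = (n - m).-1.+1)%N by lia.
by rewrite /= (_ : (1 + m.-1)%N = m) ?E ?eqxx //; lia.
Qed.

Lemma eigenvalue_rank_bound k T n : (0 < n <= k)%N ->
  (eigenvalue_rank k T n <
   count_mem (pos_eigenvalue k T n) [seq pos_eigenvalue k T m | m <- iota 1 k])%N.
Proof.
move=> /andP[n0 nk]; rewrite count_map /eigenvalue_rank.
have -> : iota 1 k = iota 1 n.-1 ++ n :: iota n.+1 (k - n).
  have {1}-> : k = (n.-1 + (k - n).+1)%N by lia.
  rewrite iotaD /= (_ : (1 + n.-1)%N = n) //; lia.
rewrite count_cat /= eqxx -[X in (X < _)%N]addn0 ltn_add2l //.
Qed.

Lemma unit_rows_controllable (R : realType) (k : nat) (e : rel 'I_k) pos T p :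
  (2 <= k)%N -> simple_graph e -> construction_order e pos T -> T k.-1 ->
  (forall c, count_mem c (conjugate_seq (degree_seq e)) <= p)%N ->
  controllable (laplacian R e)
    (unit_rows_mx R p pos (fun u => eigenvalue_rank k T (pos u))).
Proof.
move=> k2 es o Tl cp; have [pi _ _] := o.
apply: controllable_of_modes (mode_mx_unit R pi) (mode_laplacian R es o) _ => a v va.
apply: (eigenvector_unit_rows_eq0 k2 es o Tl _ _ va) => [u u0|u w u0 w0 E fE].
  apply: leq_trans (cp (pos_eigenvalue k T (pos u))).
  rewrite (permP (conjugate_degree_perm es o)); apply: eigenvalue_rank_bound.
  by rewrite u0 ltnW.
have [uw|wu|/val_inj/pi//] := ltngtP (pos u) (pos w).
  by have := eigenvalue_rank_lt _ E; rewrite u0 uw fE ltnn => /(_ isT).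
by have := eigenvalue_rank_lt _ (esym E); rewrite w0 wu fE ltnn => /(_ isT).
Qed.

(** An eigenspace of larger dimension than the target of [B] meets its left
    kernel. *)
Lemma controllable_eigenspace_rank (R : realType) (k p : nat) (L : 'M[R]_k)
    (B : 'M[R]_(k, p)) (a : R) :
  controllable L B -> (\rank (eigenspace L a) <= p)%N.
Proof.
move=> ctrl; rewrite leqNgt; apply/negP => small.
pose E := row_base (eigenspace L a).
have [|z z0] := @left_kernel_vector _ _ _ (E *m B).
  by rewrite (leq_ltn_trans (rank_leq_col _)).
rewrite mulmxA => zEB; have zEL : (z *m E) *m L = a *: (z *m E).
  apply/eigenspaceP; rewrite (submx_trans (submxMl _ _)) // eq_row_base //.
have := controllable_left_eigenvector ctrl zEL zEB.
rewrite -(mul0mx 1 E) => /(row_free_inj (row_base_free _)) /eqP.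
by rewrite (negbTE z0).
Qed.

Theorem mainTheorem4 (R : realType) (k : nat) (e : rel 'I_k)
    (k_ge2 : (2 <= k)%N)
    (e_simple : simple_graph e)
    (e_connected : graph_connected e)
    (e_threshold : threshold_graph e)
    (degree_sorted : forall i j : 'I_k, (i <= j)%N -> (degree e j <= degree e i)%N) :
  let L := laplacian R e in
  let d := degree_seq e in
  let dstar := conjugate_seq d in
  let ktilde := size (distinct_values d) in
  let max_mstar := (\max_(i < size (distinct_values dstar)) mult dstar i)%N in
  (forall i : nat, (i < ktilde)%N ->
     is_minimum
       (fun r => exists (p : nat) (B : 'M[R]_(k, p)),
          controllable L B /\ \rank (row_block (mbar d i) (mbar d i.+1) B) = r)
       (mult d i - 1)%N)
  /\ [/\ is_minimum
           (fun p => exists B : 'M[R]_(k, p), binary_mx B /\ controllable L B)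
           max_mstar,
         is_maximum
           (fun m => exists2 a : R, eigenvalue L a & \rank (eigenspace L a) = m)
           max_mstar &
         is_minimum
           (fun p => exists B : 'M[R]_(k, p), terminal_mx B /\ controllable L B)
           (k - ktilde)%N].
Proof.
move=> L d dstar ktilde max_mstar.
have [esym _] := e_simple.
have [pos [T o]] := threshold_construction_order esym e_threshold.
have Tl := connected_last_dominating k_ge2 e_simple e_connected o.
have ctrl_reps := select_nonreps_controllable (R := R) k_ge2 e_simple o Tl.
have card_nonreps : #|~: class_reps e| = (k - ktilde)%N.
  rewrite /ktilde /d -card_class_reps -[k in (k - _)%N](card_ord k).
  by rewrite -(cardsC (class_reps e)) addKn.
split=> [i ik|].
  have blockE := degree_block degree_sorted ik; rewrite -/d in blockE.
  have cardE_ : #|[set r : 'I_k | (mbar d i <= r < mbar d i.+1)%N]| = mult d i.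
    by rewrite blockE /mult /d count_degree_seq.
  have inblock u : u \in [set r : 'I_k | (mbar d i <= r < mbar d i.+1)%N] ->
      degree e u = nth 0%N (distinct_values d) i.
    by rewrite blockE inE => /eqP.
  have lower p (B : 'M[R]_(k, p)) : controllable L B ->
      (mult d i - 1 <= \rank (row_block (mbar d i) (mbar d i.+1) B))%N.
    by rewrite -cardE_ => ctrl; exact: controllable_class_rank o ctrl inblock.
  split; last by move=> r [p [B [ctrl <-]]]; exact: lower.
  exists #|~: class_reps e|, (select_mx R (~: class_reps e)); split=> //.
  apply/eqP; rewrite eqn_leq lower // andbT.
  have [u du] : exists u, degree e u = nth 0%N (distinct_values d) i.
    have : nth 0%N (distinct_values d) i \in d by rewrite -mem_distinct_values mem_nth.
    by case/mapP => u _ ->; exists u.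
  have [r rr dr] := class_reps_exist e u.
  have rA : r \in [set r : 'I_k | (mbar d i <= r < mbar d i.+1)%N].
    by rewrite blockE inE dr du.
  have : (\rank (row_block (mbar d i) (mbar d i.+1) (select_mx R (~: class_reps e))) <
          mult d i)%N.
    rewrite -cardE_; apply: (@zero_row_rank _ _ _ _ (enum_rank_in rA r)).
    by rewrite row_rowsub enum_rankK_in // row_select_mx // inE rr.
  lia.
have le_max := count_mem_max_mult dstar.
have [|c cd cmax] := @max_mult_attained dstar.
  by rewrite size_map size_iota size_map size_enum_ord; lia.
split.
- split.
    exists (unit_rows_mx R max_mstar pos (fun u => eigenvalue_rank k T (pos u))).
    by split; [exact: unit_rows_binary | exact: unit_rows_controllable].
  move=> p [B [_ ctrl]].
  rewrite /max_mstar -cmax -(rank_eigenspace_laplacian R c e_simple o).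
  exact: controllable_eigenspace_rank.
- split.
    exists c%:R; last by rewrite (rank_eigenspace_laplacian R c e_simple o).
    rewrite /eigenvalue -mxrank_eq0 (rank_eigenspace_laplacian R c e_simple o).
    by rewrite -lt0n -has_count has_pred1.
  move=> m [a aL <-].
  have [z0 aE] : exists n, a = n%:R.
    have [pi _ _] := o; move: aL => /eigenvalueP[v va v0].
    have [z vE zmu] := eigenvector_expansion (mode_mx_unit R pi)
                         (mode_laplacian R e_simple o) va.
    have /rV0Pn[j /zmu] : z != 0 by apply: contra_neq v0; rewrite vE => ->; rewrite mul0mx.
    by rewrite mxE => <-; eexists.
  by rewrite aE (rank_eigenspace_laplacian R z0 e_simple o).
- split.
    rewrite -card_nonreps; exists (select_mx R (~: class_reps e)).
    by split=> //; exact: select_mx_terminal.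
  move=> p [B [term ctrl]]; exact: controllable_terminal_size o ctrl term.
Qed.
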